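(* Let $S=\{s_1,\dots,s_n\}$ be a finite poset whose Hasse graph $\Gamma(S)$ is connected, and suppose the quadratic form $f_S$ is positive semidefinite. Then $C(f_S)=\varnothing$ if and only if $S$ is isomorphic to $\zeta(r)$ for some rational number $r\ge 1$ (i.e. $S$ is an $r$-set).
   Context: For a finite poset $S=\{s_1,\dots,s_n\}$, $f_S(x_1,\dots,x_n)=\sum_{(i,j):\,s_i\le s_j}x_ix_j=\sum_i x_i^2+\sum_{s_i<s_j}x_ix_j$, so $\frac{\partial f_S}{\partial x_m}(x)=2x_m+\sum_{j\ne m,\ s_j\text{ comparable with }s_m}x_j$. Let $H_n=\{x\in\mathbb R^n:\sum_i x_i=0\}$. For a differentiable $f$ on $\mathbb R^n$, $C^-(f)=\{h\in H_n\setminus\{0\}: \frac{\partial f}{\partial x_i}(h)\le 0\ \forall i\}$, $C^+(f)=\{h\in H_n\setminus\{0\}: \frac{\partial f}{\partial x_i}(h)\ge 0\ \forall i\}$, $C(f)=C^+(f)\cup C^-(f)$. The Hasse graph $\Gamma(S)$ has vertex set $S$ and an edge between $s,s'$ when one covers the other. A wattle $\langle n_1,\dots,n_t\rangle$ ($t\ge2$, all $n_i\ge2$) is the poset which is a disjoint union of chains $Z_1,\dots,Z_t$ with $|Z_i|=n_i$, where for $i=1,\dots,t-1$ the minimal element of $Z_i$ is less than the maximal element of $Z_{i+1}$, and there are no other comparabilities between elements of different chains. For a non-integer rational $r>1$, write $r-[r]=q/t$ in lowest terms ($t\ge2$) and put $n_1=n_t=[r]+1$, $n_i=[ri]-[r(i-1)]+1$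 for $2\le i\le t-1$; then $\zeta(r)=\langle n_1,\dots,n_t\rangle$. For a positive integer $r$, $\zeta(r)$ is the chain with $r$ elements. ($[\cdot]$ is the integer part.) *)

(* Defs.v *)
From HB Require Import structures.
From mathcomp Require Import all_boot all_order all_algebra.
From mathcomp Require Import archimedean.
From mathcomp Require Import reals.
Set Implicit Arguments. Unset Strict Implicit. Unset Printing Implicit Defensive.
Import Order.TTheory GRing.Theory Num.Theory.
Local Open Scope ring_scope.

Definition is_partial_order (T : finType) (le : rel T) : Prop :=
  [/\ reflexive le, antisymmetric le & transitive le].

Definition pstrict (T : finType) (le : rel T) : rel T :=
  fun x y => (x != y) && le x y.
Definition covers (T : finType) (le : rel T) : rel T :=
  fun x y => pstrict le x y && [forall z, ~~ (pstrict le x z && pstrict le z y)].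

Definition hasse_edge (T : finType) (le : rel T) : rel T :=
  fun x y => covers le x y || covers le y x.

Definition hasse_connected (T : finType) (le : rel T) : Prop :=
  (0 < #|T|)%N /\ forall x y : T, connect (hasse_edge le) x y.

Section Forms.
Variable R : realType.
Definition fS (T : finType) (le : rel T) (x : T -> R) : R :=
  \sum_(i : T) \sum_(j : T | le i j) x i * x j.

(* partial derivative of f_S w.r.t. x_m (explicit formula from the context) *)
Definition dfS (T : finType) (le : rel T) (x : T -> R) (m : T) : R :=
  2 * x m + \sum_(j : T | (j != m) && (le j m || le m j)) x j.

Definition psd (T : finType) (le : rel T) : Prop :=
  forall x : T -> R, 0 <= fS le x.

Definition inH0 (T : finType) (h : T -> R) : Prop :=
  \sum_(i : T) h i = 0 /\ exists i, h i != 0.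

Definition Cminus (T : finType) (le : rel T) (h : T -> R) : Prop :=
  inH0 h /\ forall i, dfS le h i <= 0.
Definition Cplus (T : finType) (le : rel T) (h : T -> R) : Prop :=
  inH0 h /\ forall i, dfS le h i >= 0.
Definition C_fS (T : finType) (le : rel T) (h : T -> R) : Prop :=
  Cplus le h \/ Cminus le h.
Definition C_empty (T : finType) (le : rel T) : Prop :=
  forall h : T -> R, ~ C_fS le h.
End Forms.

(* Wattle <n_1,...,n_t> (also the chain when t = 1), given by the list ns of
   chain sizes.  Elements are pairs (i,k), i < t (chain index, 0-based),
   k < n_(i+1) (position in the chain, 0 = minimal, n-1 = maximal). *)
Definition wattle_elem (ns : seq nat) (p : nat * nat) : bool :=
  (p.1 < size ns)%N && (p.2 < nth 0%N ns p.1)%N.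

Definition wattle_le (ns : seq nat) (p q : nat * nat) : bool :=
  ((p.1 == q.1) && (p.2 <= q.2)%N) ||
  [&& q.1 == p.1.+1, p.2 == 0%N & q.2 == (nth 0%N ns q.1).-1].

Definition zeta_sizes (r : rat) : seq nat :=
  let m := Num.floor r in
  if denq r == 1 then [:: `|m|%N] else
  let t := `|denq (r - m%:~R)|%N in
  [seq (if (i == 1%N) || (i == t) then (`|m|.+1)%N
        else (`|Num.floor (r * i%:R) - Num.floor (r * (i.-1)%:R)|.+1)%N)
  | i <- iota 1 t].

Definition iso_to_wattle (T : finType) (le : rel T) (ns : seq nat) : Prop :=
  exists phi : T -> nat * nat,
    [/\ injective phi,
        forall x, wattle_elem ns (phi x),
        forall p, wattle_elem ns p -> exists x, phi x = p &
        forall x y, le x y = wattle_le ns (phi x) (phi y)].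

Definition is_r_set (T : finType) (le : rel T) : Prop :=
  exists r : rat, 1 <= r /\ iso_to_wattle le (zeta_sizes r).

(* Main.v *)
Require Import Defs.
From Stdlib Require Import ZArith.
From mathcomp Require Import all_boot all_order all_algebra.
From mathcomp Require Import archimedean.
From mathcomp Require Import reals.
From mathcomp Require Import zify ssrZ ring lra.
Set Implicit Arguments. Unset Strict Implicit. Unset Printing Implicit Defensive.
Import Order.TTheory GRing.Theory Num.Theory.
Local Open Scope ring_scope.

(** Write [lap h] for the gradient of the form at [h], i.e. the matrix [A = 2 + Adj]
of the comparability graph applied to [h].  If [C] is empty, then [A] is positive
definite and [A lam = 1] for a strictly positive [lam]: moreover no [h <> 0] with
[sum h <= 0] has [A h >= 0].

The last fact is used constructively: if [h] lives on a subset [t] of vertices and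
looks like a counterexample on [t], then some new vertex [x] has a negative product
with [h].  Since positive definiteness leaves few ways of adding [x] (the lattice is a
root lattice, and E8 cannot be extended), a finite search shows that there are no
claws, and that every diamond [s, v; a, b] contains an odd triangle, i.e. one that
looks like the three edges of a triangle in a line graph.  An odd triangle forces
weight 1/2 on a clique next to it; following these cliques away from the triangle one
never finds an end, so there are no diamonds at all.

Without claws and diamonds each vertex lies in at most two maximal cliques, whose
weights sum to 1.  The cliques of weight > 1/2 partition the poset into chains, those
of weight < 1/2 are edges from the bottom of a chain to the top of another one, and
this is a wattle.  On a wattle the equation [A lam = 1] says that equal supplies at the
chains are transported to equal demands along a tree; solving it from one end to the
other shows that [lam > 0] exactly for the sizes given by the integer parts [[r i]]. *)

(** * The gradient of the form *)

Section Laplacian.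
Variables (R : realFieldType) (T : finType) (e : rel T).
Hypotheses (e_sym : symmetric e) (e_irr : irreflexive e).
Implicit Types (x y h : T -> R) (i j u v : T).

Definition lap x i : R := 2 * x i + \sum_(j | e i j) x j.
Definition delta v : T -> R := fun i => (i == v)%:R.

Definition positive_definite := forall x,
  \sum_i x i * lap x i <= 0 -> forall i, x i = 0.
Definition no_dominated := forall h,
  (forall i, 0 <= lap h i) -> \sum_i h i <= 0 -> forall i, h i = 0.

Lemma eq_lap x y : x =1 y -> lap x =1 lap y.
Proof. by move=> xy i; rewrite /lap xy; congr (_ + _); apply: eq_bigr. Qed.

Lemma lapD x y i : lap (fun j => x j + y j) i = lap x i + lap y i.
Proof. by rewrite /lap big_split /=; ring. Qed.

Lemma lapZ c x i : lap (fun j => c * x j) i = c * lap x i.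
Proof. by rewrite /lap mulrDr mulr_sumr; ring. Qed.

Lemma lapB x y i : lap (fun j => x j - y j) i = lap x i - lap y i.
Proof.
have -> : lap (fun j => x j - y j) i = lap (fun j => x j + -1 * y j) i.
  by apply: eq_lap => j; ring.
by rewrite lapD lapZ; ring.
Qed.

Lemma sum_delta v (P : pred T) : \sum_(j | P j) delta v j = (P v)%:R.
Proof.
rewrite /delta; case Pv: (P v).
  by rewrite (bigD1 v) //= eqxx big1 ?addr0 // => j /andP[_ /negbTE->].
rewrite big1 // => j Pj; case: eqP => // jv; by rewrite -jv Pj in Pv.
Qed.

Lemma lap_delta v i : lap (delta v) i = 2 * (i == v)%:R + (e i v)%:R.
Proof. by rewrite /lap sum_delta. Qed.

Lemma lap_sym x y : \sum_i x i * lap y i = \sum_i y i * lap x i.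
Proof.
have E a b : \sum_i a i * lap b i =
    \sum_i 2 * (a i * b i) + \sum_i \sum_(j | e i j) a i * b j.
  rewrite -big_split /=; apply: eq_bigr => i _.
  by rewrite /lap mulrDr mulr_sumr; congr (_ + _); ring.
rewrite !E; congr (_ + _); first by apply: eq_bigr => i _; ring.
rewrite (exchange_big_dep predT) //=; apply: eq_bigr => i _.
by apply: eq_big => [j|j _]; rewrite 1?e_sym // mulrC.
Qed.

Lemma sum_delta_mul v x : \sum_i delta v i * x i = x v.
Proof.
rewrite (bigD1 v) //= /delta eqxx mul1r big1 ?addr0 // => i /negbTE->.
by rewrite mul0r.
Qed.

End Laplacian.

(** * Search for configurations without positive weight *)

Section Search.
Local Open Scope Z_scope.

(* A graph on a list of vertices is the list of its rows: the row of a vertex is the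
   mask of its neighbours among the vertices that come after it in the list. *)
Fixpoint mask_dot (h : seq Z) (m : seq bool) : Z :=
  match h, m with
  | a :: h', b :: m' => if b then a + mask_dot h' m' else mask_dot h' m'
  | _, _ => 0
  end.

Fixpoint mask_add (a : Z) (m : seq bool) (h : seq Z) : seq Z :=
  match m, h with
  | b :: m', c :: h' => (if b then a + c else c) :: mask_add a m' h'
  | _, _ => [::]
  end.

(** Only half of the symmetric matrix is stored, so each row is used twice: against the tail of [h]
    for its own coordinate and, through [mask_add], for the later coordinates. *)
Fixpoint form_mul (g : seq (seq bool)) (h : seq Z) : seq Z :=
  match g, h with
  | m :: g', a :: h' => (2 * a + mask_dot h' m) :: mask_add a m (form_mul g' h')
  | _, _ => [::]
  end.

Fixpoint zdot (h k : seq Z) : Z :=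
  match h, k with
  | a :: h', b :: k' => a * b + zdot h' k'
  | _, _ => 0
  end.

Definition zsum (h : seq Z) : Z := foldr Z.add 0 h.

(* The Gram matrix of [st_graph] has determinant [st_det] and adjugate [st_adj]; this
   invariant is not proved, since every vector read off the adjugate is checked. *)
Record state := State { st_graph : seq (seq bool); st_det : Z; st_adj : seq (seq Z) }.

(** Bordering: if [d] and [B] are the determinant and adjugate of the old Gram matrix and [y = B m],
    the new determinant is [d' = 2 d - y.m] and the lower block of the new adjugate is
    [(d' B + y y^T) / d], an exact division. *)
Definition st_ext (st : state) (m : seq bool) : state :=
  let y := [seq mask_dot r m | r <- st_adj st] in
  let d' := 2 * st_det st - mask_dot y m in
  State (m :: st_graph st) d'
   ((st_det st :: [seq - a | a <- y]) ::
    [seq - p.1 :: [seq (d' * q.2 + p.1 * q.1) / st_det st | q <- zip y p.2]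
    | p <- zip y (st_adj st)]).

Definition st_of (g : seq (seq bool)) : state :=
  foldr (fun m st => st_ext st m) (State [::] 1 [::]) g.

Fixpoint masks (n : nat) : seq (seq bool) :=
  if n is n'.+1 then
    [seq true :: m | m <- masks n'] ++ [seq false :: m | m <- masks n']
  else [:: [::]].

Definition adjacent (g : seq (seq bool)) (i j : nat) : bool :=
  if (i < j)%N then nth false (nth [::] g i) (j - i.+1) else
  if (j < i)%N then nth false (nth [::] g j) (i - j.+1) else false.

Definition has_claw (g : seq (seq bool)) : bool :=
  let V := iota 0 (size g) in
  has (fun s => has (fun a => adjacent g s a &&
    has (fun b => [&& (a < b)%N, adjacent g s b, ~~ adjacent g a b &
      has (fun c => [&& (b < c)%N, adjacent g s c, ~~ adjacent g a c &
        ~~ adjacent g b c]) V]) V) V) V.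

(* If [A] is the Gram matrix and [m] the new row, the vector [(- det A, adj A m)] has
   norm [det A * det A'], where [A'] is the extended Gram matrix. *)
Definition indefinite (st : state) (m : seq bool) : bool :=
  let h := (- st_det st) :: [seq mask_dot r m | r <- st_adj st] in
  [&& size (st_adj st) == size (st_graph st), ~~ (st_det st =? 0) &
      zdot h (form_mul (m :: st_graph st) h) <=? 0].

Definition is_certificate (g : seq (seq bool)) (h : seq Z) : bool :=
  [&& size h == size g, zsum h <=? 0, all (fun a => 0 <=? a) (form_mul g h) &
      has (fun a => ~~ (a =? 0)) h].

(* A row of the adjugate is mapped by the Gram matrix to a multiple of a basis vector. *)
Definition certificate (st : state) : seq Z :=
  head [::] [seq r <- st_adj st | zsum r <=? 0].

(* Nested conditionals instead of [||], whose arguments would all be evaluated. *)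
Fixpoint search (cl : bool) (k : nat) (st : state) : bool :=
  if k is k'.+1 then
    let h := certificate st in
    if is_certificate (st_graph st) h then
      all (fun m => if 0 <=? mask_dot h m then true else
          if indefinite st m then true else
          if cl && has_claw (m :: st_graph st) then true else
          search cl k' (st_ext st m))
        (masks (size (st_graph st)))
    else false
  else false.

(** The leaves come first and the centre last, as in the list used by [claw_freeP]. *)
Definition claw_graph : seq (seq bool) :=
  [:: [:: false; false; true]; [:: false; true]; [:: true]; [::]].

(* The vertices of the diamond are listed as b, a, v, s. *)
Definition diamond_graph : seq (seq bool) :=
  [:: [:: false; true; true]; [:: true; true]; [:: true]; [::]].

Definition branch (next : state -> bool) (st : state) (m : seq bool) : bool :=
  if indefinite st m then true else
  if has_claw (m :: st_graph st) then true else next (st_ext st m).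

Definition odd_mask (m : seq bool) (b v s : nat) : bool :=
  nth false m b == nth false m s (+) nth false m v.

(** A vertex refuting the oddness of [s, v, b] is added first. If it also refutes [s, v, a], the
    general search takes over; otherwise a second refuting vertex is put in front, which shifts the
    old indices by one. *)
Definition diamond_search : bool :=
  all (fun m => if odd_mask m 0 2 3 then true else
    branch (fun st => if ~~ odd_mask m 1 2 3 then search true 6 st else
      all (fun m' => if odd_mask m' 2 3 4 then true else branch (search true 6) st m')
        (masks 5)) (st_of diamond_graph) m) (masks 4).

(** The flag is [false] because claw-freeness is what this run establishes. The number 6 bounds the
    depth, and every branch closes before it is exhausted. *)
Lemma claw_search_true : search false 6 (st_of claw_graph).
Proof. vm_cast_no_check (erefl true). Qed.

Lemma diamond_search_true : diamond_search.
Proof. vm_cast_no_check (erefl true). Qed.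

End Search.

#[local] Arguments Z.mul : simpl never.
#[local] Arguments Z.add : simpl never.
#[local] Arguments Z.eqb : simpl never.

(** * Soundness of the search *)

Section Soundness.
Variables (R : realFieldType) (T : finType) (e : rel T).
Hypotheses (e_sym : symmetric e) (e_irr : irreflexive e).
Hypotheses (pdef : positive_definite R e) (nodom : no_dominated R e).

Definition zr (z : Z) : R := (int_of_Z z)%:~R.

Lemma zrD a b : zr (Z.add a b) = zr a + zr b.
Proof. by rewrite /zr -intrD -rmorphD. Qed.
Lemma zrM a b : zr (Z.mul a b) = zr a * zr b.
Proof. by rewrite /zr -intrM -rmorphM. Qed.
Lemma zr_le0 a : Z.leb a 0 -> zr a <= 0.
Proof. by move=> h; rewrite /zr lerz0; lia. Qed.
Lemma zr_ge0 a : Z.leb 0 a = (0 <= zr a).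
Proof. by rewrite /zr ler0z; lia. Qed.
Lemma zr_eq0 a : Z.eqb a 0 = (zr a == 0).
Proof. by rewrite /zr intr_eq0; lia. Qed.

Fixpoint vec (h : seq Z) (t : seq T) : T -> R :=
  match h, t with
  | a :: h', v :: t' => fun i => zr a * delta R v i + vec h' t' i
  | _, _ => fun=> 0
  end.

Fixpoint rows (t : seq T) : seq (seq bool) :=
  if t is v :: t' then [seq e v w | w <- t'] :: rows t' else [::].

Lemma size_rows t : size (rows t) = size t.
Proof. by elim: t => //= v t ->. Qed.

Lemma lap_vec_cons a h v t x : lap e (vec (a :: h) (v :: t)) x =
  zr a * (2 * (x == v)%:R + (e x v)%:R) + lap e (vec h t) x.
Proof. by rewrite -lap_delta -lapZ -lapD. Qed.

Lemma lap0 x : lap e (fun=> 0 : R) x = 0.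
Proof. by rewrite /lap big1 // mulr0 addr0. Qed.

Lemma lap_vec_notin h t x : x \notin t ->
  lap e (vec h t) x = zr (mask_dot h [seq e x v | v <- t]).
Proof.
elim: h t => [|a h IH] [|v t] xt; rewrite ?lap0 //.
move: xt; rewrite inE negb_or => /andP[/negbTE xv xt].
rewrite lap_vec_cons xv IH //= mulr0 add0r.
by case: (e x v); rewrite ?zrD ?mulr1 // mulr0 add0r.
Qed.

Lemma vec_notin h t x : x \notin t -> vec h t x = 0.
Proof.
elim: h t => [|a h IH] [|v t] //=; rewrite inE negb_or => /andP[/negbTE xv xt].
by rewrite /delta xv mulr0 add0r IH.
Qed.

Lemma mask_add_map a (m : T -> bool) k (f : T -> R) s : map zr k = map f s ->
  map zr (mask_add a (map m s) k) = [seq (m w)%:R * zr a + f w | w <- s].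
Proof.
elim: s k => [|w s IH] [|b k] //= [bw ks]; rewrite IH // -bw.
by case: (m w); rewrite ?zrD ?mul1r // mul0r add0r.
Qed.

Lemma form_mul_rows h t : uniq t -> size h = size t ->
  map zr (form_mul (rows t) h) = map (lap e (vec h t)) t.
Proof.
elim: t h => [|v t IH] [|a h] //= /andP[vt ut] [sht].
rewrite (mask_add_map _ _ (IH _ ut sht)); congr (_ :: _).
  rewrite lap_vec_cons eqxx e_irr addr0 lap_vec_notin // zrD zrM mulr1.
  by rewrite [zr a * 2]mulrC.
apply/eq_in_map => w wt.
have /negbTE wv : w != v by apply: contraNneq vt => <-.
by rewrite lap_vec_cons wv mulr0 add0r e_sym mulrC.
Qed.

Lemma sum_vec h k t F : size h = size t -> map zr k = map F t ->
  \sum_i vec h t i * F i = zr (zdot h k).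
Proof.
elim: t h k => [|v t IH] [|a h] [|b k] //=.
  by move=> _ _; apply: big1 => i _; rewrite mul0r.
move=> [sht] [bF kF]; rewrite zrD zrM bF -(IH _ _ sht kF) -(sum_delta_mul v F).
rewrite mulr_sumr -big_split /=; apply: eq_bigr => i _; ring.
Qed.

Lemma sum_vec1 h t : size h = size t -> \sum_i vec h t i = zr (zsum h).
Proof.
elim: t h => [|v t IH] [|a h] //=; first by move=> _; apply: big1.
move=> [sht]; rewrite zrD -(IH _ sht) big_split /= -mulr_sumr.
by rewrite (sum_delta R v predT) mulr1.
Qed.

Lemma vec_eq0 h t : uniq t -> size h = size t ->
  (forall i, vec h t i = 0) -> all (fun a => Z.eqb a 0) h.
Proof.
elim: t h => [|v t IH] [|a h] //= /andP[vt ut] [sht] h0.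
have a0 : zr a = 0.
  by have := h0 v; rewrite /delta eqxx mulr1 vec_notin // addr0.
rewrite zr_eq0 a0 eqxx; apply: IH => // i.
by have := h0 i; rewrite a0 mul0r add0r.
Qed.

Lemma has_not0 h : has (fun a => ~~ Z.eqb a 0) h = ~~ all (fun a => Z.eqb a 0) h.
Proof. by rewrite -has_predC. Qed.

Lemma null_vector_absurd h t : uniq t -> size h = size t ->
  has (fun a => ~~ Z.eqb a 0) h -> Z.leb (zdot h (form_mul (rows t) h)) 0 -> False.
Proof.
move=> ut sht; rewrite has_not0 => /negP h0 /zr_le0.
rewrite -(sum_vec (t := t) (F := lap e (vec h t))) ?form_mul_rows // => /pdef v0.
exact/h0/(vec_eq0 ut sht).
Qed.

(** Were all products with outside vertices nonnegative, the gradient of the vector would be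
    nonnegative everywhere, inside [t] by the certificate, and [no_dominated] would make the vector
    zero. *)
Lemma certificate_extend h t : uniq t -> is_certificate (rows t) h ->
  exists2 x, x \notin t & Z.ltb (mask_dot h [seq e x v | v <- t]) 0.
Proof.
move=> ut /and4P[/eqP]; rewrite size_rows => sht s0 A0.
rewrite has_not0 => /negP h0.
have [/existsP[x]|] := boolP [exists x, lap e (vec h t) x < 0].
  move=> x0; have xt : x \notin t.
    apply/negP => xt; move: x0; rewrite ltNge => /negP[].
    have : lap e (vec h t) x \in map zr (form_mul (rows t) h).
      by rewrite form_mul_rows //; apply: map_f.
    by case/mapP => z /(allP A0); rewrite zr_ge0 => z0 ->.
  exists x => //; move: x0; rewrite lap_vec_notin //.
  by rewrite ltNge -zr_ge0; lia.
rewrite negb_exists => /forallP ge0; case: h0.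
apply: (vec_eq0 ut sht); apply: nodom => [i|]; first by rewrite leNgt.
by rewrite sum_vec1 // zr_le0.
Qed.

Definition claw_free := forall s a b c, e s a -> e s b -> e s c ->
  a != b -> a != c -> b != c -> ~~ e a b -> ~~ e a c -> e b c.

Lemma nth_rows x0 t i : (i < size t)%N ->
  nth [::] (rows t) i = [seq e (nth x0 t i) w | w <- drop i.+1 t].
Proof. by elim: t i => [|v t IH] [|i] //= it; rewrite ?drop0 // IH. Qed.

Lemma adjacent_rows x0 t i j : (i < size t)%N -> (j < size t)%N -> i != j ->
  adjacent (rows t) i j = e (nth x0 t i) (nth x0 t j).
Proof.
move=> it jt; rewrite /adjacent neq_ltn => /orP[] lt_ij.
  rewrite lt_ij (nth_rows x0) // (nth_map x0) ?nth_drop ?size_drop; last lia.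
  by rewrite subnKC.
rewrite lt_ij ltnNge (ltnW lt_ij) /= (nth_rows x0) // (nth_map x0) ?nth_drop ?size_drop; last lia.
by rewrite subnKC // e_sym.
Qed.

Lemma adjacentii g i : adjacent g i i = false.
Proof. by rewrite /adjacent ltnn. Qed.

Lemma claw_free_rows t : uniq t -> claw_free -> ~~ has_claw (rows t).
Proof.
move=> ut cf; apply/negP; rewrite /has_claw size_rows.
case/hasP=> s; rewrite mem_iota => /= s_t /hasP[a]; rewrite mem_iota => /= a_t.
case/andP=> sa /hasP[b]; rewrite mem_iota => /= b_t /and4P[ab sb nab].
case/hasP=> c; rewrite mem_iota => /= c_t /and4P[bc sc nac nbc].
case: t ut s_t a_t b_t c_t sa sb nab sc nac nbc => // x0 t0.
set t := x0 :: t0 => ut s_t a_t b_t c_t sa sb nab sc nac nbc.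
have neq i : adjacent (rows t) s i -> s != i.
  by apply: contraTneq => <-; rewrite adjacentii.
move: (neq _ sa) (neq _ sb) (neq _ sc) => nsa nsb nsc.
move: sa sb nab sc nac nbc; rewrite !(adjacent_rows x0) //; try lia.
move=> sa sb nab sc nac /negP[]; apply: (cf _ _ _ _ sa sb sc) => //.
all: rewrite nth_uniq //; lia.
Qed.

Lemma mem_masks n (m : seq bool) : size m = n -> m \in masks n.
Proof.
elim: n m => [|n IH] [|b m] //= [smn]; rewrite mem_cat.
by case: b; rewrite map_f ?IH // orbT.
Qed.

Lemma indefinite_absurd st t x : uniq (x :: t) -> rows t = st_graph st ->
  indefinite st [seq e x v | v <- t] -> False.
Proof.
move=> u gt /and3P[/eqP sz d0 q0].
apply: (null_vector_absurd u _ _ (h := _ :: _)); last first.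
- by rewrite /= gt; exact: q0.
- by rewrite /=; apply/orP; left; lia.
by rewrite /= size_map sz -gt size_rows.
Qed.

(** Induction on the depth: the vertex supplied by [certificate_extend] realises one of the masks,
    and every mask not refuted on the spot is searched further. *)
Lemma search_absurd (cl : bool) k st t : (cl -> claw_free) -> uniq t -> rows t = st_graph st ->
  search cl k st -> False.
Proof.
move=> cf; elim: k st t => [|k IH] st t //= ut gt.
case: ifP => // ct /allP chk.
rewrite -gt in ct; have [x xt hx] := certificate_extend ut ct.
have ux : uniq (x :: t) by rewrite /= xt.
have := chk [seq e x v | v <- t].
rewrite mem_masks ?size_map -?gt ?size_rows // => /(_ isT).
case: ifP => [|_]; first lia.
case: ifP => [/(indefinite_absurd ux gt)//|_].
case: ifP => [/andP[/cf cf']|_].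
  by rewrite (negbTE (claw_free_rows ux cf')).
by apply: (IH _ (x :: t)) => //=; rewrite gt.
Qed.

#[local] Opaque search indefinite has_claw.

Lemma claw_freeP : claw_free.
Proof.
move=> s a b c sa sb sc ab ac bc nab nac; apply/negPn/negP => nbc.
have neq x y : e x y -> x != y by apply: contraTneq => ->; rewrite e_irr.
apply: (search_absurd _ _ _ claw_search_true (t := [:: c; b; a; s])).
- by [].
- by rewrite /= !inE !negb_or (eq_sym c b) (eq_sym c a) (eq_sym b a) ab ac bc !neq // e_sym.
rewrite /= ![e _ s]e_sym sa sb sc (e_sym c b) (e_sym c a) (e_sym b a).
by rewrite (negbTE nab) (negbTE nac) (negbTE nbc).
Qed.

Lemma branch_next next st t x : uniq (x :: t) -> rows t = st_graph st ->
  branch next st [seq e x w | w <- t] ->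
  let st' := st_ext st [seq e x w | w <- t] in rows (x :: t) = st_graph st' /\ next st'.
Proof.
move=> ux gt br st'; move: br; rewrite /branch -/st'.
case: ifP => [/(indefinite_absurd ux gt)//|_].
have gx : rows (x :: t) = st_graph st' by rewrite /rows -/rows gt.
case: ifP => [cl|_ nx]; last by [].
by have := claw_free_rows ux claw_freeP; rewrite gx cl.
Qed.

(* In a line graph this says that s, v, b are the edges of a triangle (rather than of
   a star): every other edge meets an even number of them. *)
Definition odd_triangle s v b := forall x, x \notin [:: s; v; b] ->
  e x b = e x s (+) e x v.

Lemma odd_triangleP s v b : reflect (odd_triangle s v b)
  [forall x, (x \notin [:: s; v; b]) ==> (e x b == e x s (+) e x v)].
Proof.
apply: (iffP forallP) => h x; first by move=> xn; apply/eqP/(implyP (h x)).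
by apply/implyP => /h/eqP.
Qed.

Lemma diamond_odd_triangle s v a b : e s v -> e a s -> e a v -> e b s -> e b v ->
  a != b -> ~~ e a b -> odd_triangle s v b \/ odd_triangle s v a.
Proof.
move=> sv as_ av bs bv ab nab.
have neq x y : e x y -> x != y by apply: contraTneq => ->; rewrite e_irr.
have [/odd_triangleP|] := boolP [forall x, (x \notin [:: s; v; b]) ==>
  (e x b == e x s (+) e x v)]; first by left.
rewrite negb_forall => /existsP[x]; rewrite negb_imply => /andP[xn xb].
have [/odd_triangleP|] := boolP [forall x, (x \notin [:: s; v; a]) ==>
  (e x a == e x s (+) e x v)]; first by right.
rewrite negb_forall => /existsP[y]; rewrite negb_imply => /andP[yn ya].
exfalso; set t := [:: b; a; v; s].
have ut : uniq t.
  by rewrite /= !inE !negb_or (eq_sym b a) ab !neq // e_sym.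
have gt : rows t = st_graph (st_of diamond_graph).
  by rewrite /= (e_sym b a) (negbTE nab) bv bs av as_ e_sym sv.
have xt : x \notin t.
  move: xn; rewrite !inE !negb_or => /and3P[-> -> ->]; rewrite /= !andbT.
  (* The vertex [a] satisfies the parity condition of [s, v, b], being adjacent to [s] and [v] but
     not to [b], so it is not [x]. *)
  by apply: contraNneq xb => ->; rewrite as_ av (negbTE nab).
have yt : y \notin t.
  move: yn; rewrite !inE !negb_or => /and3P[-> -> ->]; rewrite /= ?andbT.
  by apply: contraNneq ya => ->; rewrite bs bv e_sym (negbTE nab).
have ux : uniq (x :: t) by rewrite cons_uniq xt.
have := allP (diamond_search_true : all _ (masks 4)) _
  (mem_masks (erefl : size [seq e x w | w <- t] = 4%N)).
case: ifP => [/(negP xb)//|_] /(branch_next ux gt)[gx].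
case: ifP => [_|/negbFE/eqP xa].
  by apply: (search_absurd _ ux gx) => _; apply: claw_freeP.
(* In this case [x] respects the parity condition of [s, v, a] and [y] violates it. *)
have yx : y \notin x :: t.
  by rewrite inE negb_or yt andbT; apply: contraNneq ya => ->; apply/eqP.
have uy : uniq (y :: x :: t) by rewrite cons_uniq yx.
move=> chk; have := allP chk _ (mem_masks (erefl : size [seq e y w | w <- x :: t] = 5%N)).
case: ifP => [/(negP ya)//|_] /(branch_next uy gx)[gy].
by apply: (search_absurd _ uy gy) => _; apply: claw_freeP.
Qed.

End Soundness.

(** * Weights of a poset with empty C *)

Section Weights.
Variables (R : realFieldType) (T : finType) (e : rel T).
Hypothesis e_sym : symmetric e.
Implicit Types (x y h : T -> R).

Lemma lap_sum_delta x i : lap e x i = \sum_j x j * lap e (delta R j) i.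
Proof.
rewrite /lap; under [RHS]eq_bigr => j _ do rewrite sum_delta mulrDr.
rewrite big_split /=; congr (_ + _).
  rewrite (bigD1 i) //= /delta eqxx big1 ?addr0 ?mulr1 1?mulrC //.
  by move=> j /negbTE ji; rewrite eq_sym ji !mulr0.
rewrite [LHS]big_mkcond /=; apply: eq_bigr => j _.
by case: (e i j); rewrite ?mulr1 ?mulr0.
Qed.

Lemma lap_onto : (forall x, (forall i, lap e x i = 0) -> forall i, x i = 0) ->
  forall c, exists x, forall i, lap e x i = c i.
Proof.
move=> inj c.
pose A : 'M[R]_#|T| := \matrix_(i, j) lap e (delta R (enum_val i)) (enum_val j).
have mulAE (v : 'rV_#|T|) j :
    (v *m A) 0 j = lap e (fun t => v 0 (enum_rank t)) (enum_val j).
  rewrite mxE lap_sum_delta (reindex _ (onW_bij _ (enum_val_bij T))) /=.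
  by apply: eq_bigr => k _; rewrite mxE enum_valK.
have Aunit : A \in unitmx.
  rewrite -row_free_unit; apply: inj_row_free => v vA0.
  have v0 : forall t, v 0 (enum_rank t) = 0.
    apply: (inj (fun t => v 0 (enum_rank t))) => t.
    by rewrite -[t]enum_rankK -mulAE vA0 mxE.
  by apply/rowP => j; rewrite -[j]enum_valK v0 mxE.
pose v := (\row_j c (enum_val j)) *m invmx A.
exists (fun t => v 0 (enum_rank t)) => i.
by rewrite -[i]enum_rankK -mulAE mulmxKV // mxE enum_rankK.
Qed.

Lemma lap_inj : positive_definite R e ->
  forall x, (forall i, lap e x i = 0) -> forall i, x i = 0.
Proof. by move=> pd x x0; apply: pd; rewrite big1 // => i _; rewrite x0 mulr0. Qed.

(** By symmetry of the matrix, [lam i] is the sum of the solution [h] of [lap h = delta i]. The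
    gradient of [h] is nonnegative, so a sum at most 0 would force [h] to vanish. *)
Lemma positive_weight : positive_definite R e -> no_dominated R e ->
  exists lam : T -> R, (forall i, 0 < lam i) /\ (forall i, lap e lam i = 1).
Proof.
move=> pd nd; have onto := lap_onto (lap_inj pd).
have [lam lam1] := onto (fun=> 1); exists lam; split=> // i.
have [h hi] := onto (delta R i).
have -> : lam i = \sum_j h j.
  rewrite -(sum_delta_mul i lam) -(eq_bigr _ (fun j _ => congr1 ( *%R^~ (lam j)) (hi j))).
  under eq_bigr => j _ do rewrite mulrC.
  by rewrite lap_sym //; apply: eq_bigr => j _; rewrite lam1 mulr1.
rewrite ltNge; apply/negP => h0.
have := nd h _ h0; have hge j : 0 <= lap e h j by rewrite hi /delta ler0n.
move/(_ hge) => hz; have : lap e h i = 0.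
  by rewrite (eq_lap e (fun j => hz j : h j = (fun=> 0) j)) /lap big1 // mulr0 addr0.
by rewrite hi /delta eqxx => /eqP; rewrite oner_eq0.
Qed.

End Weights.

(** * The comparability graph *)

Section Poset.
Variables (T : finType) (le : rel T).
Hypothesis le_po : is_partial_order le.

(** Written in the same form as the index set of [dfS], so that the gradient is [lap cmp] by
    conversion. *)
Definition cmp : rel T := fun x y => (y != x) && (le y x || le x y).

Lemma cmp_sym : symmetric cmp.
Proof. by move=> x y; rewrite /cmp eq_sym orbC. Qed.
Lemma cmp_irr : irreflexive cmp.
Proof. by move=> x; rewrite /cmp eqxx. Qed.

Lemma dfS_lap (R : realType) (x : T -> R) m : dfS le x m = lap cmp x m.
Proof. by []. Qed.

(** Euler's identity for a form of degree two: each comparable pair contributes to the right-hand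
    side from both of its ends. *)
Lemma fS_lap (R : realType) (x : T -> R) : 2 * fS le x = \sum_i x i * lap cmp x i.
Proof.
case: le_po => refl anti _.
have lt (i : T) : \sum_(j | le i j) x i * x j =
    x i * x i + \sum_(j | (j != i) && le i j) x i * x j.
  by rewrite (bigD1 i) //=; congr (_ + _); apply: eq_bigl => j; rewrite andbC.
pose S := \sum_i \sum_(j | (j != i) && le i j) x i * x j.
have fE : fS le x = \sum_i x i * x i + S.
  by rewrite -big_split; apply: eq_bigr => i _; rewrite lt.
have S' : S = \sum_i \sum_(j | (j != i) && le j i) x i * x j.
  rewrite /S (exchange_big_dep predT) //=; apply: eq_bigr => i _.
  by apply: eq_big => [j|j _]; rewrite 1?eq_sym // mulrC.
have -> : \sum_i x i * lap cmp x i = 2 * \sum_i x i * x i + (S + S).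
  rewrite {2}S' /S mulr_sumr -!big_split; apply: eq_bigr => i _ /=.
  rewrite /lap mulrDr mulr_sumr; congr (_ + _); first by ring.
  rewrite (bigID (fun j => le i j)) /=; congr (_ + _); apply: eq_bigl => j.
    by rewrite /cmp; case: (le i j); rewrite ?orbT ?andbT ?andbF.
  rewrite /cmp; case ji: (j == i) => //=; case lij: (le i j); rewrite ?andbF ?andbT ?orbF //=.
  apply/esym/negP => lji; move/eqP: ji; apply; apply: anti.
  by rewrite lij lji.
by rewrite fE; ring.
Qed.

End Poset.

Section FromEmptiness.
Variables (R : realType) (T : finType) (le : rel T).
Hypothesis le_po : is_partial_order le.
Let e := cmp le.
Let e_irr : irreflexive e := @cmp_irr T le.
Let e_sym : symmetric e := @cmp_sym T le.

Lemma psd_null (x : T -> R) : psd R le -> \sum_i x i * lap e x i <= 0 ->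
  forall i, lap e x i = 0.
Proof.
move=> ps x0 i; set l := lap e x i.
(* Along the coordinate [i] the form is smallest at this shift, where twice the form has dropped by
   [l ^+ 2 / 2]. *)
pose y := fun j => x j + (- l / 2) * delta R i j.
have := ps y; rewrite -(pmulr_rge0 _ (ltr0n _ 2)) (fS_lap le_po) -/e.
have -> : \sum_j y j * lap e y j = \sum_j x j * lap e x j - l ^+ 2 / 2.
  have -> : \sum_j y j * lap e y j = \sum_j x j * lap e x j
      + (- l / 2) * (\sum_j x j * lap e (delta R i) j) +
      (- l / 2) * (\sum_j delta R i j * lap e x j)
      + (- l / 2) ^+ 2 * (\sum_j delta R i j * lap e (delta R i) j).
    rewrite !mulr_sumr -!big_split /=; apply: eq_bigr => j _.
    by rewrite /y lapD lapZ; ring.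
  rewrite (lap_sym e_sym x (delta R i)) !sum_delta_mul lap_delta eqxx e_irr -/l mulr1 addr0.
  by field.
by move=> h; apply/eqP; rewrite -sqrf_eq0; apply/eqP; have := sqr_ge0 l; lra.
Qed.

(** A vector with nonpositive sum is brought into the hyperplane by adding a nonnegative multiple of
    a basis vector, which keeps the gradient nonnegative. *)
Lemma C_empty_no_dominated : C_empty R le -> no_dominated R e.
Proof.
move=> ce h h0 s0.
have [/forallP hz i|] := boolP [forall i, h i == 0]; first exact/eqP.
rewrite negb_forall => /existsP[i hi]; exfalso.
pose c := - \sum_j h j; pose k := fun j => h j + c * delta R i j.
have kE j : lap e k j = lap e h j + c * lap e (delta R i) j by rewrite lapD lapZ.
have c0 : 0 <= c by rewrite oppr_ge0.
have d0 j : 0 <= lap e (delta R i) j.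
  by rewrite lap_delta addr_ge0 // mulr_ge0.
apply: (ce k); left; split=> [|j]; last first.
  by rewrite dfS_lap kE addr_ge0 // mulr_ge0.
split.
  by rewrite big_split /= -mulr_sumr (sum_delta R i predT) mulr1 /c subrr.
(* If [k] vanished, [h] would be [- c] times a basis vector, with gradient [- 2 c] at [i]. Then
   [c = 0], and [k] is the nonzero [h] after all. *)
have [/forallP kz|] := boolP [forall j, k j == 0]; last first.
  by rewrite negb_forall => /existsP.
have : lap e h i + c * 2 = 0.
  transitivity (lap e k i).
    by rewrite kE lap_delta eqxx e_irr mulr1 addr0.
  by rewrite /lap (eqP (kz i)) mulr0 add0r big1 // => j _; apply/eqP.
move=> lc; have cz : c = 0 by have := h0 i; lra.
exists i; rewrite /k cz mul0r addr0; exact: hi.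
Qed.

(** An isotropic vector has zero gradient by [psd_null], so [no_dominated] applies to it or to its
    opposite, whichever has nonpositive sum. *)
Lemma C_empty_positive_definite : psd R le -> C_empty R le ->
  positive_definite R e.
Proof.
move=> ps ce x x0; have xz := psd_null ps x0.
have nd := C_empty_no_dominated ce.
have [s0|s0] := leP (\sum_i x i) 0; first by apply: nd => // i; rewrite xz.
move=> i; have := nd (fun j => -1 * x j) _ _ i.
suff E : -1 * x i = 0 -> x i = 0.
  move=> h; apply/E/h => [j|]; first by rewrite lapZ xz mulr0.
  by rewrite -mulr_sumr mulN1r oppr_le0 ltW.
by rewrite mulN1r => /eqP; rewrite oppr_eq0 => /eqP.
Qed.

End FromEmptiness.

(** * Diamonds *)

Section StrictOrder.
Variables (T : finType) (le : rel T).
Hypothesis le_po : is_partial_order le.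
Let e := cmp le.
Let lt := pstrict le.

Lemma pstrict_trans : transitive lt.
Proof.
case: le_po => _ anti tr y x z /andP[xy lxy] /andP[yz lyz].
rewrite /lt /pstrict (tr _ _ _ lxy lyz) andbT; apply: contraNneq xy => xz.
by apply/eqP/anti; rewrite lxy xz lyz.
Qed.

Lemma pstrict_irr : irreflexive lt.
Proof. by move=> x; rewrite /lt /pstrict eqxx. Qed.

Lemma pstrict_asym x y : lt x y -> lt y x -> False.
Proof. by move=> xy /(pstrict_trans xy); rewrite pstrict_irr. Qed.

Lemma cmpE x y : e x y = lt x y || lt y x.
Proof. by rewrite /e /cmp /lt /pstrict [x == y]eq_sym; case: (y != x); rewrite //= orbC. Qed.

End StrictOrder.

(** The common value [- w] is odd, hence 1 or -1. The value -1 would need both third bits, so it is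
    1 and each triple has one of its first two bits set. *)
Lemma odd_tri_value (w : int) (a1 a2 a3 c1 c2 c3 : bool) :
  - w = a1%:Z + a2%:Z - a3%:Z -> - w = c1%:Z + c2%:Z - c3%:Z ->
  (2 %| w)%Z = false -> ~~ (a3 && c3) -> (a1 || a2) && (c1 || c2).
Proof.
move=> Ea; have -> : w = - (a1%:Z + a2%:Z - a3%:Z) by rewrite -Ea opprK.
rewrite {Ea} opprK; by case: a1 a2 a3 c1 c2 c3 => [] [] [] [] [] [].
Qed.

Section OddTriangle.
Variables (R : realFieldType) (T : finType) (le : rel T).
Hypothesis le_po : is_partial_order le.
Let e := cmp le.
Let lt := pstrict le.
Let e_irr : irreflexive e := @cmp_irr T le.
Let e_sym : symmetric e := @cmp_sym T le.
Let eE x y : e x y = lt x y || lt y x := cmpE le x y.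
Let lt_trans {x y z} : lt x y -> lt y z -> lt x z := @pstrict_trans T le le_po y x z.
Hypotheses (pdef : positive_definite R e) (nodom : no_dominated R e).
Variable lam : T -> R.
Hypotheses (lam_gt0 : forall i, 0 < lam i) (lam1 : forall i, lap e lam i = 1).

Let cf : claw_free e := claw_freeP e_sym e_irr pdef nodom.

Lemma cmp_neq x y : e x y -> x != y.
Proof. by apply: contraTneq => ->; rewrite e_irr. Qed.

(** The alternating vector on an induced 4-cycle is isotropic. *)
Lemma square_free a x b v : e a x -> e x b -> e b v -> e v a ->
  a != b -> x != v -> e a b || e x v.
Proof.
move=> ax xb bv va ab xv; apply/negPn; rewrite negb_or; apply/negP => /andP[nab nxv].
apply: (null_vector_absurd e_sym e_irr pdef (t := [:: a; x; b; v])
  (h := [:: Zpos 1; Zneg 1; Zpos 1; Zneg 1])) => //.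
  by rewrite /= !inE !negb_or ab xv !cmp_neq // e_sym.
by rewrite /= ax (negbTE nab) (e_sym a v) va xb (negbTE nxv) bv.
Qed.

Definition wt (K : {set T}) : R := \sum_(i in K) lam i.
Definition toR (u : T -> int) : T -> R := fun x => (u x)%:~R.

(** Pair [lam] with [lap u]: since [lap lam = 1] the result is the sum of [u], and it is also twice
    the weight of [K]. *)
Lemma wt_half (u : T -> int) (K : {set T}) :
  (forall x, lap e (toR u) x = 2 * (x \in K)%:R) -> \sum_x u x = 1 -> wt K = 1 / 2.
Proof.
move=> uK u1.
have : \sum_x lam x * lap e (toR u) x = 1.
  rewrite lap_sym // -[RHS](rmorph1 intr) -u1 rmorph_sum /=.
  by apply: eq_bigr => x _; rewrite lam1 mulr1.
have -> : \sum_x lam x * lap e (toR u) x = 2 * wt K.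
  rewrite /wt [in RHS]big_mkcond /= mulr_sumr; apply: eq_bigr => x _.
  by rewrite uK; case: (x \in K); rewrite ?mulr1 ?mulr0 // mulrC.
by move=> h; lra.
Qed.

(** If all neighbours of [a] were in [K], the weight equation at [a] would give [1 <= lam a + wt K],
    whereas [lam a + lam c <= 1 / 2] and [lam c > 0]. *)
Lemma exit_half a c (K : {set T}) : wt K = 1 / 2 -> a \in K -> c \in K -> c != a ->
  exists2 d, e a d & d \notin K.
Proof.
move=> wK aK cK ca.
have [/existsP[d /andP[? ?]]|] := boolP [exists d, e a d && (d \notin K)]; first by exists d.
rewrite negb_exists => /forallP out.
have sub : \sum_(j | e a j) lam j <= wt K - lam a.
  rewrite /wt [X in _ <= X - _](bigD1 a) //= addrAC subrr add0r big_mkcond [leRHS]big_mkcond /=.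
  apply: ler_sum => j _; case: ifP => [aj|_]; last by case: ifP => // _; rewrite ltW.
  have := out j; rewrite aj /= negbK => ->.
  by rewrite eq_sym cmp_neq.
have lt_a : lam a + lam c <= wt K.
  rewrite /wt (bigD1 a) //= (bigD1 c) /= ?cK //= addrA lerDl.
  by apply: sumr_ge0 => j _; rewrite ltW.
by have := lam1 a; rewrite /lap; have := lam_gt0 c; lra.
Qed.

(** If [s], [v], [b] are the edges pq, pr, qr of a triangle in a line graph, then [s + v - b] is
    twice the basis vector of p, and [apex] is the clique of all edges through p. *)
Definition tri s v b : T -> int := fun x => (x == s)%:Z + (x == v)%:Z - (x == b)%:Z.
Definition apex s v b : {set T} := [set x | [|| x == s, x == v | [&& x != b, e x s & e x v]]].

Lemma lap_tri s v b : e s v -> e b s -> e b v -> odd_triangle e s v b ->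
  forall x, lap e (toR (tri s v b)) x = 2 * (x \in apex s v b)%:R.
Proof.
move=> sv bs bv odd_svb x.
have -> : lap e (toR (tri s v b)) x =
   lap e (delta R s) x + lap e (delta R v) x - lap e (delta R b) x.
  rewrite -lapD -lapB; apply: eq_lap => y.
  by rewrite /toR /tri /delta intrB intrD.
rewrite !lap_delta inE.
have [->|xs] := eqVneq x s.
  rewrite (negbTE (cmp_neq sv)) (eq_sym s b) (negbTE (cmp_neq bs)) e_irr sv.
  by rewrite (e_sym s b) bs /=; ring.
have [->|xv] := eqVneq x v.
  by rewrite (eq_sym v b) (negbTE (cmp_neq bv)) e_irr (e_sym v s) sv (e_sym v b) bv /=; ring.
have [->|xb] := eqVneq x b; first by rewrite e_irr bs bv /=; ring.
rewrite odd_svb /=; last by rewrite !inE !negb_or xs xv.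
by case: (e x s); case: (e x v) => /=; ring.
Qed.

Lemma sum_tri s v b : \sum_x tri s v b x = 1.
Proof.
have one y : \sum_x (x == y)%:Z = 1.
  by rewrite (bigD1 y) //= eqxx big1 // => x /negbTE->.
by rewrite /tri sumrB big_split /= !one.
Qed.

Section Fixed.
Variables s v b a0 : T.
Hypotheses (sv : e s v) (bs : e b s) (bv : e b v) (odd_svb : odd_triangle e s v b).
Let P := apex s v b.

Lemma apexE x : x \notin [:: s; v] -> (x \in P) = [&& x != b, e x s & e x v].
Proof. by rewrite !inE negb_or => /andP[/negbTE-> /negbTE->]. Qed.

Lemma apex_nb x : x \in P -> x \notin [:: s; v] -> ~~ e x b.
Proof.
move=> xP xn; move: xP; rewrite apexE // => /and3P[xb xs xv].
rewrite odd_svb ?xs ?xv //; move: xn; rewrite !inE !negb_or => /andP[-> ->]; exact: xb.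
Qed.

(** A missing edge would be a claw at [s] whose third leaf is [b], which [apex_nb] separates from
    the other two. *)
Lemma apex_sub a k : a \in P -> a \notin [:: s; v] -> k \in P -> k != a -> e a k.
Proof.
move=> aP an kP ka; have nab := apex_nb aP an.
move: (aP); rewrite apexE // => /and3P[ab as_ av].
have [|kn] := boolP (k \in [:: s; v]); first by rewrite !inE => /orP[]/eqP->.
have nkb := apex_nb kP kn.
move: (kP); rewrite apexE // => /and3P[kb ks kv].
by apply: (cf (s := s) (a := b)); rewrite 1?e_sym // 1?eq_sym // e_sym.
Qed.

(** By oddness, a [d] adjacent to just one of [s] and [v] is adjacent to [b], which closes an
    induced 4-cycle through [a], [b] and the other one. *)
Lemma apex_out a d : a \in P -> a \notin [:: s; v] -> e a d -> d \notin P ->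
  [/\ d != b, ~~ e d s, ~~ e d v & ~~ e d b].
Proof.
move=> aP an ad dP; have nab := apex_nb aP an.
move: (aP); rewrite apexE // => /and3P[ab as_ av].
have dn : d \notin [:: s; v].
  by apply: contra dP; rewrite !inE => /orP[]/eqP->; rewrite eqxx ?orbT.
have db : d != b by apply: contraNneq nab => <-.
have dn3 : d \notin [:: s; v; b] by move: dn; rewrite !inE !negb_or => /andP[-> ->].
move: dP; rewrite apexE // db /= => nds.
move: (dn); rewrite !inE negb_or => /andP[ds dv].
have dbE := odd_svb dn3.
have nd_s : ~~ e d s.
  apply/negP => es; rewrite es /= in nds dbE; rewrite (negbTE nds) in dbE.
  have := square_free ad dbE bv; rewrite e_sym av => /(_ isT ab dv).
  by rewrite (negbTE nab) (negbTE nds).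
have nd_v : ~~ e d v.
  apply/negP => ev; rewrite ev (negbTE nd_s) /= in dbE.
  have := square_free ad dbE bs; rewrite e_sym as_ => /(_ isT ab ds).
  by rewrite (negbTE nab) (negbTE nd_s).
by split=> //; rewrite dbE (negbTE nd_s) (negbTE nd_v).
Qed.

Lemma apex_sep a k d : a \in P -> a \notin [:: s; v] -> k \in P -> k != a ->
  e a d -> d \notin P -> ~~ e k d.
Proof.
move=> aP an kP ka ad dP; have [db nds ndv ndb] := apex_out aP an ad dP.
have [|kn] := boolP (k \in [:: s; v]).
  by rewrite !inE => /orP[]/eqP->; rewrite e_sym.
have ak := apex_sub aP an kP ka.
have nab := apex_nb aP an; have nkb := apex_nb kP kn.
move: (aP) (kP); rewrite !apexE // => /and3P[ab as_ av] /and3P[kb ks kv].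
apply/negP => kd.
(* Two odd triangles with the same apex clique give two expressions of the same functional. *)
apply: (null_vector_absurd e_sym e_irr pdef (t := [:: d; k; a; b; v; s])
  (h := [:: Zpos 1; Zneg 1; Zneg 1; Zneg 1; Zpos 1; Zpos 1])) => //.
  have dn : d \notin [:: s; v].
    by apply: contra dP; rewrite !inE => /orP[]/eqP->; rewrite eqxx ?orbT.
  rewrite !inE negb_or in dn; case/andP: dn => ds dv.
  by rewrite /= !inE !negb_or db ds dv kb ab ka (eq_sym d k) (eq_sym d a) !cmp_neq // e_sym.
rewrite /= (e_sym d k) kd (e_sym d a) ad (negbTE ndb) (negbTE ndv) (negbTE nds).
by rewrite (e_sym k a) ak (negbTE nkb) kv ks (negbTE nab) av as_ bv bs (e_sym v s) sv.
Qed.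

Lemma mem_apex_s : s \in P. Proof. by rewrite inE eqxx. Qed.
Lemma apex_exit a : a \in P -> a \notin [:: s; v] -> exists2 d, e a d & d \notin P.
Proof.
move=> aP an; apply: (exit_half _ aP mem_apex_s).
  by apply: (wt_half (u := tri s v b)); [apply: lap_tri | apply: sum_tri].
by move: an; rewrite !inE negb_or eq_sym => /andP[].
Qed.

Lemma apex_below a : a \in P -> a \notin [:: s; v] -> lt b s -> lt a s.
Proof.
move=> aP an bs_; move: (aP); rewrite apexE // => /and3P[_ as_ _].
move: as_; rewrite eE => /orP[]// sa.
by have := apex_nb aP an; rewrite eE (lt_trans bs_ sa) orbT.
Qed.

Lemma apex_above a : a \in P -> a \notin [:: s; v] -> lt s b -> lt s a.
Proof.
move=> aP an bs_; move: (aP); rewrite apexE // => /and3P[_ as_ _].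
move: as_; rewrite eE => /orP[]// sa.
by have := apex_nb aP an; rewrite eE (lt_trans sa bs_).
Qed.

(** Take an exit [d] from whichever of the two is nearer to [s] in the order. By transitivity [d] is
    comparable with the farther one or with [s]; [apex_sep] and [apex_out] exclude both. *)
Lemma apex_unique a k : a \in P -> a \notin [:: s; v] -> k \in P -> k \notin [:: s; v] ->
  a = k.
Proof.
move=> aP an kP kn; apply/eqP/negPn/negP => ak.
wlog ak' : a k aP an kP kn ak / lt a k.
  move=> W; have := apex_sub aP an kP; rewrite eq_sym ak => /(_ isT).
  rewrite eE => /orP[] ?; first exact: (W a k).
  by apply: (W k a) => //; rewrite eq_sym.
move: bs; rewrite eE => /orP[] bs'.
  have [d kd dP] := apex_exit kP kn; have [_ nds _ _] := apex_out kP kn kd dP.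
  have := apex_sep kP kn aP ak kd dP; move: kd; rewrite eE => /orP[] kd.
    by rewrite eE (lt_trans ak' kd).
  by move: nds; rewrite eE (lt_trans kd (apex_below kP kn bs')).
have [d kd dP] := apex_exit aP an; have [_ nds _ _] := apex_out aP an kd dP.
have := apex_sep aP an kP; rewrite eq_sym ak => /(_ _ isT kd dP).
move: kd; rewrite eE => /orP[] kd.
  by move: nds; rewrite eE (lt_trans (apex_above aP an bs') kd) orbT.
by rewrite eE (lt_trans kd ak') orbT.
Qed.

(* A step of the walk away from the odd triangle: [V] is the set of visited vertices,
   [a] the current one and [K] the clique of weight 1/2 through which it was reached.
   The signs and parities of [u] record how [2 * 1_K] is obtained from the triangle. *)
Record stage (V K : {set T}) (a : T) (u : T -> int) : Prop := Stage {
  stage_new : a \notin V;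
  stage_off : a \notin [:: s; v; b];
  stage_mem : a \in K;
  stage_nbr : forall k, k \in K -> k != a -> e a k;
  stage_base : exists2 c, c \in K & c != a;
  stage_sep : forall k d, k \in K -> k != a -> e a d -> d \notin K -> ~~ e k d;
  stage_lap : forall x, lap e (toR u) x = 2 * (x \in K)%:R;
  stage_sum : \sum_x u x = 1;
  stage_odd : forall x, (2 %| u x)%Z = (x \notin [:: s; v; b]);
  stage_sgn : u v = u s;
  stage_closed : forall w y, w \in V -> e w y -> [\/ y \in V, y = a | y \in [:: s; v]];
  stage_back : forall w, w \in V -> e w a -> w \in K;
  stage_sub : forall k, k \in K -> [\/ k \in V, k = a | k \in [:: s; v]];
  stage_start : a0 \in V \/ (s \in K /\ a = a0) }.

Hypotheses (a0P : a0 \in P) (a0n : a0 \notin [:: s; v]).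

Section Step.
Variables (V K : {set T}) (a : T) (u : T -> int).
Hypothesis S : stage V K a u.

(** In the line graph picture [a] is an edge pq and [u] represents 2p; then [2 a - u] represents 2q,
    and this is the clique at the other end q of [a]. *)
Definition next_clique : {set T} := [set x | (x == a) || e a x && (x \notin K)].
Definition next_form : T -> int := fun x => 2 * (x == a)%:Z - u x.
Let K' := next_clique.
Let u' := next_form.

Lemma next_lap x : lap e (toR u') x = 2 * (x \in K')%:R.
Proof.
have -> : lap e (toR u') x = 2 * lap e (delta R a) x - lap e (toR u) x.
  rewrite -lapZ -lapB; apply: eq_lap => y.
  by rewrite /toR /u' /next_form /delta intrB intrM.
rewrite lap_delta (stage_lap S) inE.
have [->|xa] := eqVneq x a; first by rewrite e_irr (stage_mem S) /=; ring.
rewrite e_sym; have [xK|xK] := boolP (x \in K).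
  by rewrite (stage_nbr S) //=; ring.
by case: (e a x) => /=; ring.
Qed.

Lemma next_sum : \sum_x u' x = 1.
Proof.
rewrite sumrB (stage_sum S) -mulr_sumr (bigD1 a) //= eqxx big1 // => x /negbTE.
by move->.
Qed.

Lemma next_wt : wt K' = 1 / 2.
Proof. exact: wt_half next_lap next_sum. Qed.

Lemma next_odd x : (2 %| u' x)%Z = (x \notin [:: s; v; b]).
Proof. by rewrite -(stage_odd S) /u' /next_form; lia. Qed.

Lemma off_triangle x : x \in [:: s; v; b] -> (x == a) = false.
Proof. by move=> xn; apply: contraTF xn => /eqP->; exact: stage_off S. Qed.

Lemma out_adj d d' : e a d -> d \notin K -> e a d' -> d' \notin K -> d != d' -> e d d'.
Proof.
move=> ad dK ad' dK' dd'; have [c cK ca] := stage_base S.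
have cd x : x \notin K -> c != x by move=> xK; apply: contraNneq xK => <-.
exact: (cf (stage_nbr S cK ca) ad ad' (cd _ dK) (cd _ dK') dd'
  (stage_sep S cK ca ad dK) (stage_sep S cK ca ad' dK')).
Qed.

Lemma next_exit d : e a d -> d \notin K ->
  exists x, [/\ e d x, x \notin K', x != a & ~~ e a x].
Proof.
move=> ad dK; have dK' : d \in K' by rewrite inE ad dK orbT.
have aK' : a \in K' by rewrite inE eqxx.
have [x dx xK'] := exit_half next_wt dK' aK' (cmp_neq ad).
have := xK'; rewrite inE negb_or negb_and negbK => /andP[xa].
have [ax /= xK|nax _] := boolP (e a x); last by exists x.
by have := stage_sep S xK xa ad dK; rewrite e_sym dx.
Qed.

Lemma out_side c : c \in K -> c != a ->
  (forall d, e a d -> d \notin K -> lt d a) \/ (forall d, e a d -> d \notin K -> lt a d).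
Proof.
move=> cK ca; have := stage_nbr S cK ca; rewrite eE => /orP[] h; [right|left].
  move=> d ad dK; have := stage_sep S cK ca ad dK.
  move: ad; rewrite !eE => /orP[]// da; by rewrite (lt_trans da h) orbT.
move=> d ad dK; have := stage_sep S cK ca ad dK.
by move: ad; rewrite !eE => /orP[]// da; rewrite (lt_trans h da).
Qed.

(* A second odd triangle gives another expression of [next_form], so by
   injectivity of the Laplacian the walk has returned to its start. *)
Lemma no_second_triangle d1 d2 x : e a d1 -> d1 \notin K -> e a d2 -> d2 \notin K ->
  e d1 d2 -> e d1 x -> e d2 x -> x != a -> ~~ e a x -> x \notin K' -> False.
Proof.
move=> ad1 d1K ad2 d2K d12 d1x d2x xa nax xK'.
have [c cK ca] := stage_base S.
(* The alternative, that [d1, d2, a] is odd, is refuted by [c], which meets [a] but neither [d1] nor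
   [d2]. *)
have odd_x : odd_triangle e d1 d2 x.
  have [] // : odd_triangle e d1 d2 x \/ odd_triangle e d1 d2 a.
    by apply: (diamond_odd_triangle e_sym e_irr pdef nodom); rewrite // 1?eq_sym // e_sym.
  move=> /(_ c); rewrite !inE (negbTE ca).
  have -> : (c == d1) = false by apply: contraNF d1K => /eqP<-.
  have -> : (c == d2) = false by apply: contraNF d2K => /eqP<-.
  move=> /(_ isT); rewrite e_sym (stage_nbr S) //.
  by rewrite (negbTE (stage_sep S cK ca ad1 d1K)) (negbTE (stage_sep S cK ca ad2 d2K)).
have xd1 : e x d1 by rewrite e_sym.
have xd2 : e x d2 by rewrite e_sym.
have KE : apex d1 d2 x =i K'.
  move=> y; rewrite !inE.
  have [->|yd1] := eqVneq y d1; first by rewrite ad1 d1K orbT.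
  have [->|yd2] := eqVneq y d2; first by rewrite ad2 d2K !orbT.
  have [->|ya] := eqVneq y a; first by rewrite eq_sym xa ad1 ad2.
  apply/idP/idP => /= [/and3P[yx yd1' yd2']|/andP[ay yK]].
    have nyx : ~~ e y x.
      by rewrite odd_x ?yd1' ?yd2' // !inE !negb_or yd1 yd2 yx.
    have ay : e a y.
      apply: (cf (s := d1) (a := x)); rewrite // 1?eq_sym // e_sym //.
    rewrite ay; apply/negP => yK.
    by have := stage_sep S yK ya ad1 d1K; rewrite yd1'.
  have yx : y != x.
    apply: contraNneq xK' => <-; by rewrite inE ay yK orbT.
  by rewrite yx (out_adj ay yK ad1 d1K yd1) (out_adj ay yK ad2 d2K yd2).
have E y : u' y = tri d1 d2 x y.
  apply/eqP; rewrite -subr_eq0 -(intr_eq0 R) intrB subr_eq0; apply/eqP.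
  apply/eqP; rewrite -subr_eq0; apply/eqP.
  apply: (lap_inj pdef (x := fun y => toR u' y - toR (tri d1 d2 x) y)) => z.
  by rewrite lapB next_lap lap_tri // KE subrr.
have trE p : p \in [:: s; v; b] -> u' p = - u p.
  by move=> /off_triangle pa; rewrite /u' /next_form pa mulr0 add0r.
have sn : s \in [:: s; v; b] by rewrite !inE eqxx.
have vn : v \in [:: s; v; b] by rewrite !inE eqxx orbT.
have Es := E s; have Ev := E v; rewrite trE // in Es; rewrite trE // (stage_sgn S) in Ev.
have os := stage_odd S s; rewrite sn in os.
have nsv := cmp_neq sv.
rewrite /tri in Es Ev.
have sxv : ~~ ((s == x) && (v == x)).
  by apply: contra nsv => /andP[/eqP-> /eqP->].
(* The form has the same odd value at [s] and [v], so both are among [d1], [d2]. Then [a] lies in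
   the apex and equals [a0], which is either already visited or still has [s] in its clique. *)
have /andP[sD vD] := odd_tri_value Es Ev os sxv.
have inD y : (y == d1) || (y == d2) -> e a y && (y \notin K).
  by case/orP => /eqP->; rewrite ?ad1 ?ad2.
case/andP: (inD _ sD) => as_ sK; case/andP: (inD _ vD) => av vK.
have := stage_off S; rewrite !inE !negb_or => /and3P[ns nv nb].
have an : a \notin [:: s; v] by rewrite !inE negb_or ns.
have aP : a \in P by rewrite apexE // nb as_ av.
have aa0 := apex_unique aP an a0P a0n.
case: (stage_start S) => [|[sK' _]]; last by rewrite sK' in sK.
by rewrite -aa0 (negbTE (stage_new S)).
Qed.

(** Two exits are comparable and lie on the same side of [a]. A further exit from the one nearer to
    [a] is, by transitivity, comparable with the other as well, which is the situation of
    [no_second_triangle]. *)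
Lemma out_unique d1 d2 : e a d1 -> d1 \notin K -> e a d2 -> d2 \notin K -> d1 = d2.
Proof.
move=> ad1 d1K ad2 d2K; apply/eqP/negPn/negP => n12.
have d12 := out_adj ad1 d1K ad2 d2K n12.
wlog lt12 : d1 d2 ad1 d1K ad2 d2K n12 d12 / lt d1 d2.
  move=> W; move: (d12); rewrite eE => /orP[] ?; first exact: (W d1 d2).
  by apply: (W d2 d1) => //; rewrite 1?eq_sym // e_sym.
have [c cK ca] := stage_base S.
have [below|above] := out_side cK ca.
  have [x [d2x xK' xa nax]] := next_exit ad2 d2K.
  apply: (no_second_triangle ad1 d1K ad2 d2K d12 _ d2x xa nax xK').
  move: d2x; rewrite eE => /orP[] h.
    by rewrite eE (lt_trans lt12 h).
  by move: nax; rewrite eE (lt_trans h (below _ ad2 d2K)) orbT.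
have [x [d1x xK' xa nax]] := next_exit ad1 d1K.
apply: (no_second_triangle ad1 d1K ad2 d2K d12 d1x _ xa nax xK').
move: d1x; rewrite eE => /orP[] h.
  by move: nax; rewrite eE (lt_trans (above _ ad1 d1K) h).
by rewrite eE (lt_trans h lt12) orbT.
Qed.

Lemma next_stage : exists d, stage (a |: V) K' d u'.
Proof.
have [c cK ca] := stage_base S.
have [d ad dK] := exit_half (wt_half (stage_lap S) (stage_sum S)) (stage_mem S) cK ca.
have K'E x : (x \in K') = (x == a) || (x == d).
  rewrite inE; congr (_ || _); apply/andP/eqP => [[ax xK]|->//].
  exact: (out_unique ax xK ad dK).
have da : d != a by rewrite eq_sym cmp_neq.
have dV : d \notin V.
  by apply: contra dK => dV; apply: (stage_back S) => //; rewrite e_sym.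
have doff : d \notin [:: s; v; b].
  apply/negP => dn.
  (* By oddness [a] meets an even number of triangle vertices, so it meets another one besides
     [d]. *)
  have [d' d'n /andP[ad' dd']] : exists2 d', d' \in [:: s; v; b] & e a d' && e d d'.
    have := odd_svb (stage_off S); move: dn; rewrite !inE => /or3P[]/eqP dE.
    - rewrite -dE ad; case av: (e a v) => /= ab.
        by exists v; rewrite ?inE ?eqxx ?orbT // av dE sv.
      by exists b; rewrite ?inE ?eqxx ?orbT // ab dE e_sym.
    - rewrite -dE ad; case as_: (e a s) => /= ab.
        by exists s; rewrite ?inE ?eqxx ?orbT // as_ dE e_sym.
      by exists b; rewrite ?inE ?eqxx ?orbT // ab dE e_sym.
    rewrite -dE ad; case as_: (e a s) => /= ab.
      by exists s; rewrite ?inE ?eqxx ?orbT // as_ dE.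
    by exists v; rewrite ?inE ?eqxx ?orbT // -ab dE.
  have d'a : d' != a by rewrite eq_sym cmp_neq.
  have [d'K|d'K] := boolP (d' \in K).
    by have := stage_sep S d'K d'a ad dK; rewrite e_sym dd'.
  by move: dd'; rewrite (out_unique ad' d'K ad dK) e_irr.
exists d; split.
- by rewrite !inE negb_or da.
- exact: doff.
- by rewrite K'E eqxx orbT.
- by move=> k; rewrite K'E => /orP[]/eqP->; rewrite ?eqxx // => _; rewrite e_sym.
- by exists a; rewrite ?K'E ?eqxx // eq_sym.
- move=> k y; rewrite K'E => /orP[]/eqP->; last by rewrite eqxx.
  move=> _ dy; rewrite K'E negb_or => /andP[ya yd]; apply/negP => ay.
  have [yK|yK] := boolP (y \in K).
    by have := stage_sep S yK ya ad dK; rewrite e_sym dy.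
  by rewrite (out_unique ay yK ad dK) eqxx in yd.
- exact: next_lap.
- exact: next_sum.
- exact: next_odd.
- have sn : s \in [:: s; v; b] by rewrite !inE eqxx.
  have vn : v \in [:: s; v; b] by rewrite !inE eqxx orbT.
  by rewrite /u' /next_form !off_triangle // (stage_sgn S).
- have close y : [\/ y \in V, y = a | y \in [:: s; v]] ->
      [\/ y \in a |: V, y = d | y \in [:: s; v]].
    case=> [yV|->|?]; last by constructor 3.
      by constructor 1; rewrite !inE yV orbT.
    by constructor 1; rewrite !inE eqxx.
  move=> w y /setU1P[->|wV] wy; last exact/close/(stage_closed S wV wy).
  have [yK|yK] := boolP (y \in K); first exact/close/(stage_sub S yK).
  by constructor 2; apply: (out_unique wy yK ad dK).
- move=> w /setU1P[-> _|wV wd]; first by rewrite K'E eqxx.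
  case: (stage_closed S wV wd) => [dV'|dE|]; [by rewrite dV' in dV|by rewrite dE eqxx in da|].
  by move=> dn; case/negP: doff; move: dn; rewrite !inE => /orP[]->; rewrite ?orbT.
- move=> k; rewrite K'E => /orP[]/eqP->; first by constructor 1; rewrite !inE eqxx.
  by constructor 2.
by case: (stage_start S) => [a0V|[_ <-]]; left; rewrite !inE ?a0V ?eqxx ?orbT.
Qed.

End Step.
(** The visited set grows strictly at each step, and the type is finite. *)
Lemma stage_absurd V K a u : stage V K a u -> False.
Proof.
have [n] := ubnP #|~: V|; elim: n V K a u => // n IH V K a u Vn S.
have [d S'] := next_stage S; apply: (IH _ _ _ _ _ S').
rewrite -ltnS; apply: leq_trans Vn; rewrite ltnS; apply: proper_card.
rewrite setCU; apply/properP; split; first exact: subsetIr.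
by exists a; rewrite !inE ?eqxx ?(stage_new S).
Qed.

Lemma odd_triangle_absurd : False.
Proof.
apply: (@stage_absurd set0 P a0 (tri s v b)).
have a0b := apex_nb a0P a0n; have := a0n; rewrite !inE negb_or => /andP[a0s a0v].
move: (a0P); rewrite apexE // => /and3P[a0b' _ _].
split=> //.
- by rewrite inE.
- by rewrite !inE !negb_or a0s a0v.
- by move=> k kP ka; apply: apex_sub.
- by exists s; [apply: mem_apex_s | rewrite eq_sym].
- by move=> k d kP ka ad dP; apply: apex_sep ad dP.
- exact: lap_tri.
- exact: sum_tri.
- move=> x; have nsv := cmp_neq sv; have nbs := cmp_neq bs; have nbv := cmp_neq bv.
  rewrite /tri !inE !negb_or; have [->|] := eqVneq x s.
    by rewrite (negbTE nsv) (eq_sym s b) (negbTE nbs).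
  have [->|] := eqVneq x v; first by rewrite (eq_sym v b) (negbTE nbv).
  by case: (x == b).
- by rewrite /tri !eqxx [v == s]eq_sym (negbTE (cmp_neq sv)) (eq_sym v b)
     (eq_sym s b) (negbTE (cmp_neq bs)) (negbTE (cmp_neq bv)).
- by move=> w y; rewrite inE.
- by move=> w; rewrite inE.
- move=> k kP; have [kn|kn] := boolP (k \in [:: s; v]); first by constructor 3.
  by constructor 2; apply: apex_unique.
by right; split=> //; apply: mem_apex_s.
Qed.

End Fixed.

Lemma diamond_free s v a b : e s v -> e a s -> e a v -> e b s -> e b v -> a != b -> e a b.
Proof.
move=> sv as_ av bs bv ab; apply/negPn/negP => nab.
have inP x y : e x s -> e x v -> x != y -> x \in apex s v y.
  by move=> xs xv xy; rewrite inE xy xs xv !orbT.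
have nin x : e x s -> e x v -> x \notin [:: s; v].
  by move=> xs xv; rewrite !inE negb_or !cmp_neq.
have [o|o] := diamond_odd_triangle e_sym e_irr pdef nodom sv as_ av bs bv ab nab.
  by apply: (odd_triangle_absurd (a0 := a) sv bs bv o); auto.
by apply: (odd_triangle_absurd (a0 := b) sv as_ av o); auto; apply: inP; rewrite // eq_sym.
Qed.

End OddTriangle.

(** * Heavy chains and light edges *)

Section Structure.
Variables (R : realFieldType) (T : finType) (le : rel T).
Hypothesis le_po : is_partial_order le.
Let e := cmp le.
Let lt := pstrict le.
Let e_irr : irreflexive e := @cmp_irr T le.
Let e_sym : symmetric e := @cmp_sym T le.
Let eE x y : e x y = lt x y || lt y x := cmpE le x y.
Let lt_trans {x y z} : lt x y -> lt y z -> lt x z := @pstrict_trans T le le_po y x z.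
Let lt_asym {x y} : lt x y -> lt y x -> False := @pstrict_asym T le le_po x y.
Let neq {x y} : e x y -> x != y := @cmp_neq T le x y.
Hypotheses (pdef : positive_definite R e) (nodom : no_dominated R e).
Variable lam : T -> R.
Hypotheses (lam_gt0 : forall i, 0 < lam i) (lam1 : forall i, lap e lam i = 1).
Hypothesis conn : forall x y, connect e x y.

Let cf : claw_free e := claw_freeP e_sym e_irr pdef nodom.
Let df : forall s v a b, e s v -> e a s -> e a v -> e b s -> e b v -> a != b -> e a b :=
  diamond_free le_po pdef nodom lam_gt0 lam1.

(** In the absence of diamonds this is, for adjacent [x] and [y], the unique maximal clique
    containing both. *)
Definition clq x y : {set T} := [set z | [|| z == x, z == y | e z x && e z y]].
Definition W x y : R := wt lam (clq x y).
Definition simplicial x := forall y z, e x y -> e x z -> y != z -> e y z.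

Lemma clqC x y : clq x y = clq y x.
Proof. by apply/setP => z; rewrite !inE orbCA andbC. Qed.

Lemma clq_sub x y z : e x y -> e x z -> e y z -> clq x y \subset clq x z.
Proof.
move=> xy xz yz; apply/subsetP => w; rewrite !inE => /or3P[/eqP->|/eqP->|/andP[wx wy]].
- by rewrite eqxx.
- by rewrite (e_sym y x) xy yz !orbT.
rewrite wx; have [->|wz] := eqVneq w z; first by rewrite orbT.
by rewrite (df xy wx wy _ _ wz) ?orbT // e_sym.
Qed.

Lemma clq_eq x y z : e x y -> e x z -> e y z -> clq x y = clq x z.
Proof.
move=> xy xz yz; apply/eqP; rewrite eqEsubset !clq_sub //; by rewrite e_sym.
Qed.

Lemma wt_clq x y : e x y -> lam x + lam y <= W x y.
Proof.
move=> xy; rewrite /W /wt (bigD1 x) ?inE ?eqxx //= (bigD1 y) /=; last first.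
  by rewrite !inE eqxx orbT eq_sym neq.
by rewrite addrA lerDl sumr_ge0 // => j _; rewrite ltW.
Qed.

Lemma W_simplicial x y : simplicial x -> e x y -> lam x + W x y = 1.
Proof.
move=> sx xy; rewrite -[RHS](lam1 x) /lap /W /wt (bigD1 x) ?inE ?eqxx //=.
set A := \sum_(_ | _) _; set B := \sum_(_ | _) _.
suff -> : A = B by ring.
apply: eq_bigl => z.
rewrite !inE; have [->|zx] := eqVneq z x; first by rewrite e_irr.
rewrite andbT /=; have [->|zy] := eqVneq z y; first by rewrite xy.
apply/idP/idP => [/andP[zx' _]|xz] /=; first by rewrite e_sym.
by rewrite e_sym xz sx.
Qed.

(** Without claws the two cliques cover the neighbours of [x], and without diamonds they meet only
    in [x], which accounts for the term [2 * lam x] of the weight equation. *)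
Lemma W_split x y z : e x y -> e x z -> y != z -> ~~ e y z -> W x y + W x z = 1.
Proof.
move=> xy xz yz nyz; rewrite -[RHS](lam1 x) /lap /W /wt.
rewrite (bigD1 x) ?inE ?eqxx //= [X in _ + X](bigD1 x) ?inE ?eqxx //=.
set A := \sum_(_ | _) _; set B := \sum_(_ | _) _; set D := \sum_(_ | _) _.
suff -> : D = A + B by ring.
rewrite /D (bigID (fun w => w \in clq x y)) /=; congr (_ + _); apply: eq_bigl => w.
  rewrite !inE; have [->|wx] := eqVneq w x; first by rewrite e_irr.
  rewrite andbT /=; have [->|wy] := eqVneq w y; first by rewrite xy.
  by rewrite /= [e x w]e_sym andbA andbb.
rewrite !inE; have [->|wx] := eqVneq w x; first by rewrite e_irr.
rewrite andbT /=; have [->|wy] := eqVneq w y.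
  by rewrite (negbTE yz) (negbTE nyz) /= andbF andbF.
have [->|wz] := eqVneq w z; first by rewrite xz (e_sym z x) xz (e_sym z y) (negbTE nyz).
rewrite /= [e x w]e_sym; case wx': (e w x) => //=.
apply/idP/idP => [nwy|wz'].
  by apply: (cf (s := x) (a := y)); rewrite // 1?eq_sym // e_sym.
by apply: contra nyz => wy'; apply: (df (s := x) (v := w)); rewrite // e_sym.
Qed.

(** Neighbours on opposite sides of [x] are comparable by transitivity. Two on the same side are
    both comparable with [x] and with the given element on the other side, so a diamond would
    arise. *)
Lemma middle_simplicial y x z : lt y x -> lt x z -> simplicial x.
Proof.
move=> yx xz p q; rewrite !eE => /orP[] p' /orP[] q' pq; rewrite -eE.
- apply: (df (s := x) (v := y)); rewrite ?eE ?p' ?q' ?yx ?orbT //.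
    by rewrite (lt_trans yx p') orbT.
  by rewrite (lt_trans yx q') orbT.
- by rewrite eE (lt_trans q' p') orbT.
- by rewrite eE (lt_trans p' q').
by apply: (df (s := x) (v := z)); rewrite ?eE ?p' ?q' ?xz ?(lt_trans p' xz) ?(lt_trans q' xz) ?orbT.
Qed.

(* The vector equal to 1 on the local maxima and -1 on the local minima is null. *)
Lemma no_zigzag_cycle (C : {set T}) x0 : x0 \in C ->
  (forall x, x \in C -> exists y z, [/\ y \in C, z \in C, y != z,
     forall w, w \in C -> e x w = (w == y) || (w == z) &
     lt y x && lt z x || lt x y && lt x z]) -> False.
Proof.
move=> x0C cyc.
pose sg x : R := if x \in C then (if [exists y in C, lt y x] then 1 else -1) else 0.
have sg_hi x y : x \in C -> y \in C -> lt y x -> sg x = 1.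
  by move=> xC yC yx; rewrite /sg xC ifT //; apply/existsP; exists y; rewrite yC.
have sg_lo x y : x \in C -> y \in C -> lt x y -> sg x = -1.
  move=> xC yC xy; rewrite /sg xC ifF //; apply/existsP => -[u /andP[uC ux]].
  have [p [q [_ _ _ nb side]]] := cyc _ xC.
  have := nb _ uC; rewrite eE ux orbT => /esym.
  have := nb _ yC; rewrite eE xy => /esym /= yE uE.
  case/orP: side => /andP[hp hq].
    by case/orP: yE => /eqP yE; rewrite yE in xy; [case: (lt_asym hp xy)|case: (lt_asym hq xy)].
  by case/orP: uE => /eqP uE; rewrite uE in ux; [case: (lt_asym hp ux)|case: (lt_asym hq ux)].
have lap0 x : x \in C -> lap e sg x = 0.
  move=> xC; have [y [z [yC zC yz nb side]]] := cyc _ xC.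
  have xy : e x y by rewrite nb // eqxx.
  have xz : e x z by rewrite nb // eqxx orbT.
  rewrite /lap (bigD1 y) //= (bigD1 z) /=; last by rewrite xz eq_sym.
  rewrite big1; last first.
    move=> w /andP[/andP[xw wy] wz]; rewrite /sg; case: ifP => // wC.
    by move: xw; rewrite nb // (negbTE wy) (negbTE wz).
  case/orP: side => /andP[hy hz].
    by rewrite (sg_hi x y) // (sg_lo y x) // (sg_lo z x) //; ring.
  by rewrite (sg_lo x y) // (sg_hi y x) // (sg_hi z x) //; ring.
have z0 : forall i, sg i = 0.
  apply: pdef; rewrite big1 // => x _; have [xC|xC] := boolP (x \in C).
    by rewrite lap0 ?mulr0.
  by rewrite /sg (negbTE xC) mul0r.
have := z0 x0; rewrite /sg x0C; case: ifP => _ /eqP; rewrite ?oppr_eq0 oner_eq0 //.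
Qed.

Lemma same_side x y z : e x y -> e x z -> ~~ e y z ->
  lt y x && lt z x || lt x y && lt x z.
Proof.
rewrite !eE => /orP[] xy /orP[] xz; rewrite ?xy ?xz ?orbT //.
  by rewrite (lt_trans xz xy) orbT.
by rewrite (lt_trans xy xz).
Qed.

Lemma simplicialP x : simplicial x \/
  exists y z, [/\ e x y, e x z, y != z & ~~ e y z].
Proof.
have [/existsP[y /existsP[z /and4P[? ? ? ?]]]|] :=
  boolP [exists y, [exists z, [&& e x y, e x z, y != z & ~~ e y z]]].
  by right; exists y, z.
rewrite negb_exists => /forallP h; left=> y z xy xz yz.
have := h y; rewrite negb_exists => /forallP/(_ z).
by rewrite xy xz yz negbK.
Qed.

Lemma triangle_simplicial (x y z : T) : e x y -> e x z -> e y z ->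
  [\/ simplicial x, simplicial y | simplicial z].
Proof.
rewrite !eE => /orP[] xy /orP[] xz /orP[] yz.
- by constructor 2; apply: middle_simplicial xy yz.
- by constructor 3; apply: middle_simplicial xz yz.
- by constructor 1; apply: middle_simplicial xz xy.
- by constructor 1; apply: middle_simplicial xz xy.
- by constructor 1; apply: middle_simplicial xy xz.
- by constructor 1; apply: middle_simplicial xy xz.
- by constructor 3; apply: middle_simplicial yz xz.
by constructor 2; apply: middle_simplicial yz xy.
Qed.

Lemma connected_ind (P : T -> Prop) x0 : P x0 ->
  (forall x y, P x -> e x y -> P y) -> forall x, P x.
Proof.
move=> P0 step x; have /connectP[p + ->] := conn x0 x.
elim: p x0 P0 => //= y p IH x0 P0 /andP[xy yp]; apply: IH yp.
exact: step P0 xy.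
Qed.

Lemma connected_nbr x0 y0 : e x0 y0 -> forall x, exists y, e x y.
Proof.
move=> e0; apply: (connected_ind (x0 := x0)); first by exists y0.
by move=> x y _ xy; exists x; rewrite e_sym.
Qed.

Lemma W_simplicial_gt x y : simplicial x -> e x y -> 1 / 2 < W x y.
Proof.
move=> sx xy; have := W_simplicial sx xy; have := wt_clq xy.
by have := lam_gt0 y; lra.
Qed.

(** By [W_split] and connectedness all cliques would have weight 1/2. Then no vertex is simplicial,
    so there are no triangles, and each vertex has exactly two neighbours, on the same side: the
    whole graph is a zigzag. *)
Lemma W_neq_half x0 y0 : e x0 y0 -> W x0 y0 <> 1 / 2.
Proof.
move=> e0 half0.
have half x y z : W x y = 1 / 2 -> e x y -> e x z -> W x z = 1 / 2.
  move=> Wxy xy xz; have [<-//|yz] := eqVneq y z.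
  have [yz'|nyz] := boolP (e y z); first by rewrite /W -(clq_eq xy xz yz').
  by have := W_split xy xz yz nyz; lra.
have all_half : forall x y, e x y -> W x y = 1 / 2.
  apply: (connected_ind (x0 := x0)) => [y|x y Px xy z yz]; first exact: half half0 e0.
  by apply: (half y x) => //; rewrite 1?e_sym // /W clqC; apply: Px.
have nbr := connected_nbr e0.
have nsimp x : ~ simplicial x.
  by move=> sx; have [y xy] := nbr x; have := W_simplicial_gt sx xy; rewrite all_half // ltxx.
apply: (no_zigzag_cycle (C := setT) (x0 := x0)); first by rewrite inE.
move=> x _; have [/nsimp//|[y [z [xy xz yz nyz]]]] := simplicialP x.
exists y, z; split; rewrite ?inE //; last exact: same_side.
move=> w _; apply/idP/orP => [xw|[]/eqP->//].
have tri p q : e x p -> e x q -> e p q -> False.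
  by move=> xp xq pq; case: (triangle_simplicial xp xq pq); apply: nsimp.
have [_|wy] := eqVneq w y; first by left.
have [_|wz] := eqVneq w z; first by right.
have [yw|nyw] := boolP (e y w); first by case: (tri _ _ xy xw yw).
case: (tri z w) => //; by apply: (cf (s := x) (a := y)); rewrite // eq_sym.
Qed.

(* The heavy cliques are the chains of the wattle, the light ones its links. *)
Definition heavy x y := e x y && (1 / 2 < W x y).
Definition light x y := e x y && (W x y < 1 / 2).

Lemma heavyC x y : heavy x y = heavy y x.
Proof. by rewrite /heavy e_sym /W clqC. Qed.
Lemma lightC x y : light x y = light y x.
Proof. by rewrite /light e_sym /W clqC. Qed.

Lemma heavy_light x y : e x y -> light x y = ~~ heavy x y.
Proof.
move=> xy; rewrite /heavy /light xy /= -leNgt le_eqVlt.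
by case: eqP => //; move/W_neq_half; rewrite xy => /(_ isT).
Qed.

Lemma light_nosimplicial x y : light x y -> ~ simplicial x.
Proof. by case/andP=> xy l sx; have := W_simplicial_gt sx xy; lra. Qed.

(** So a light clique is a single edge: a triangle has a simplicial vertex, whose clique is heavy by
    [W_simplicial_gt]. *)
Lemma light_alone x y z : light x y -> e x z -> ~~ e y z.
Proof.
move=> l xz; apply/negP => yz; have xy : e x y by case/andP: l.
have xzl : light x z by rewrite /light xz /W -(clq_eq xy xz yz); case/andP: l.
have yxl : light y x by rewrite lightC.
have yzl : light y z.
  have yx : e y x by rewrite e_sym.
  by rewrite /light yz /W -(clq_eq yx yz xz); case/andP: yxl.
case: (triangle_simplicial xy xz yz); apply/light_nosimplicial.
- exact: l.
- exact: yxl.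
by rewrite lightC; exact: xzl.
Qed.

Lemma light_unique x y z : light x y -> light x z -> y = z.
Proof.
move=> l l'; apply/eqP/negPn/negP => yz.
case/andP: (l) => xy wy; case/andP: (l') => xz wz.
by have := W_split xy xz yz (light_alone l xz); lra.
Qed.

Lemma heavy_clique x y z : heavy x y -> heavy x z -> y != z -> heavy y z.
Proof.
case/andP=> xy wy /andP[xz wz] yz.
have [yz'|nyz] := boolP (e y z); last by have := W_split xy xz yz nyz; lra.
have yx : e y x by rewrite e_sym.
by rewrite /heavy yz' /W -(clq_eq yx yz' xz) clqC.
Qed.

Lemma light_low x y z : light x y -> lt x y -> heavy x z -> lt x z.
Proof.
move=> l xy /andP[]; rewrite eE => /orP[]// zx _.
have := light_alone l (z := z); rewrite eE zx orbT => /(_ isT).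
by rewrite eE (lt_trans zx xy) orbT.
Qed.

Lemma light_high x y z : light x y -> lt y x -> heavy x z -> lt z x.
Proof.
move=> l yx /andP[]; rewrite eE => /orP[]// xz _.
have := light_alone l (z := z); rewrite eE xz => /(_ isT).
by rewrite eE (lt_trans yx xz).
Qed.

Lemma heavy_nbr x y : e x y -> exists z, heavy x z.
Proof.
move=> xy; have [h|] := boolP (heavy x y); first by exists y.
rewrite -heavy_light // => l.
have [/(light_nosimplicial l)//|[p [q [xp xq pq npq]]]] := simplicialP x.
have [h|] := boolP (heavy x p); first by exists p.
rewrite -heavy_light // => lp; have [h|] := boolP (heavy x q); first by exists q.
by rewrite -heavy_light // => lq; rewrite (light_unique lp lq) eqxx in pq.
Qed.

Definition same x y := (x == y) || heavy x y.
Definition cls x : {set T} := [set y | same x y].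
Definition pos x := #|[set w | heavy x w && lt w x]|.

Lemma heavy_irr x : heavy x x = false.
Proof. by rewrite /heavy e_irr. Qed.
Lemma same_refl x : same x x. Proof. by rewrite /same eqxx. Qed.
Lemma same_sym x y : same x y = same y x.
Proof. by rewrite /same eq_sym heavyC. Qed.
Lemma same_trans x y z : same x y -> same y z -> same x z.
Proof.
rewrite /same; case/orP=> [/eqP->//|xy] /orP[/eqP<-|yz]; first by rewrite xy orbT.
have [//|xz] := eqVneq x z; apply: (heavy_clique _ yz xz); by rewrite heavyC.
Qed.

Lemma cls_eq x y : same x y -> cls x = cls y.
Proof.
move=> xy; apply/setP => z; rewrite !inE; apply/idP/idP; last exact: same_trans xy.
by apply: same_trans; rewrite same_sym.
Qed.

Lemma pos_lt x y : heavy x y -> lt x y -> (pos x < pos y)%N.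
Proof.
move=> h xy; apply/proper_card/properP; split; last first.
  by exists x; rewrite !inE ?heavy_irr // heavyC h xy.
apply/subsetP => w; rewrite !inE => /andP[xw wx]; rewrite (lt_trans wx xy) andbT.
apply: (heavy_clique h xw); apply: contraTneq wx => <-.
by apply/negP => /(lt_asym xy).
Qed.

Lemma pos_inj x y : same x y -> pos x = pos y -> x = y.
Proof.
case/orP=> [/eqP//|h] pxy; have := h; rewrite /heavy eE => /andP[/orP[] xy _].
  by have := pos_lt h xy; rewrite pxy ltnn.
by have := pos_lt (x := y) (y := x); rewrite heavyC h xy pxy ltnn => /(_ isT isT).
Qed.

Lemma pos_cls x : (pos x < #|cls x|)%N.
Proof.
apply/proper_card/properP; split; last by exists x; rewrite !inE ?same_refl ?heavy_irr.
by apply/subsetP => w; rewrite !inE /same => /andP[-> _]; rewrite orbT.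
Qed.

Lemma pos_onto x k : (k < #|cls x|)%N -> exists2 y, same x y & pos y = k.
Proof.
move=> kn; pose s := [seq pos y | y <- enum (cls x)].
have us : uniq s.
  rewrite map_inj_in_uniq ?enum_uniq // => y z; rewrite !mem_enum !inE => xy xz.
  by apply: pos_inj; apply: same_trans xz; rewrite same_sym.
have ss : {subset s <= iota 0 #|cls x|}.
  move=> _ /mapP[y + ->]; rewrite mem_enum inE mem_iota => /cls_eq->.
  exact: pos_cls.
have [|_ sE] := uniq_min_size us ss; first by rewrite size_iota size_map -cardE.
have : k \in s by rewrite sE mem_iota.
by case/mapP => y; rewrite mem_enum inE => xy ->; exists y.
Qed.

Definition top x := odflt x [pick y in cls x | pos y == #|cls x|.-1].

Lemma topP x : same x (top x) /\ pos (top x) = #|cls x|.-1.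
Proof.
rewrite /top; case: pickP => [y /andP[]|no]; first by rewrite inE => ? /eqP.
have [|y xy py] := @pos_onto x #|cls x|.-1.
  by rewrite prednK // (leq_ltn_trans _ (pos_cls x)).
by have := no y; rewrite inE xy py eqxx.
Qed.

Lemma top_eq x y : same x y -> top x = top y.
Proof.
move=> xy; have [xt px] := topP x; have [yt py] := topP y.
apply: pos_inj; last by rewrite px py (cls_eq xy).
by apply: same_trans yt; apply: same_trans xy; rewrite same_sym.
Qed.

Lemma top_same x y : top x = top y -> same x y.
Proof.
move=> txy; have [xt _] := topP x; have [yt _] := topP y.
by apply: (same_trans xt); rewrite txy same_sym.
Qed.

Lemma pos_top x : (forall z, heavy x z -> lt z x) -> pos x = #|cls x|.-1.
Proof.
move=> hx; rewrite (cardsD1 x (cls x)) inE same_refl /=; congr #|pred_of_set _|.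
apply/setP => w; rewrite !inE /same; apply/andP/andP => [[h _]|[wx]].
  by rewrite h orbT eq_sym; split=> //; apply: contraTneq h => ->; rewrite heavy_irr.
by rewrite eq_sym (negbTE wx) /= => h; split=> //; apply: hx.
Qed.

Lemma top_id x : (forall z, heavy x z -> lt z x) -> top x = x.
Proof.
move=> hx; have [xt px] := topP x.
by apply: pos_inj; [rewrite same_sym | rewrite px (pos_top hx)].
Qed.

Lemma pos_bot x : (forall z, heavy x z -> lt x z) -> pos x = 0%N.
Proof.
move=> hx; apply: eq_card0 => w; rewrite !inE; apply/negP => /andP[/hx xw].
by move/(lt_asym xw).
Qed.

(** The first argument stands for its whole chain, while the second is one specific element, which
    [link_top] shows to be the top of its chain. *)
Definition link u y := [exists x, [&& same u x, light x y & lt x y]].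

Lemma linkP u y : reflect (exists x, [/\ same u x, light x y & lt x y]) (link u y).
Proof. by apply: (iffP existsP) => -[x] => [/and3P[]|[? ? ?]]; exists x => //; apply/and3P. Qed.

Lemma link_same u u' y : same u u' -> link u y -> link u' y.
Proof.
move=> uu /linkP[x [ux l xy]]; apply/linkP; exists x; split=> //.
by apply: same_trans ux; rewrite same_sym.
Qed.

Lemma link_top u y : link u y -> top y = y.
Proof.
by case/linkP=> x [_ l xy]; apply: top_id => z; apply: (light_high _ xy); rewrite lightC.
Qed.

Lemma light_pos0 x y : light x y -> lt x y -> pos x = 0%N.
Proof. by move=> l xy; apply: pos_bot => z; apply: light_low l xy. Qed.

Lemma link_fun u y z : link u y -> link u z -> y = z.
Proof.
case/linkP=> x [ux l xy] /linkP[x' [ux' l' xy']].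
have E : x = x'.
  apply: pos_inj; last by rewrite (light_pos0 l xy) (light_pos0 l' xy').
  by apply: same_trans ux'; rewrite same_sym.
by apply: light_unique l _; rewrite E.
Qed.

Lemma link_inj u v y : link u y -> link v y -> same u v.
Proof.
case/linkP=> x [ux l _] /linkP[x' [ux' l' _]].
apply: (same_trans ux); rewrite same_sym.
suff -> : x = x' by [].
by apply: (light_unique (x := y)); rewrite lightC.
Qed.

(** Otherwise choosing a predecessor is an injective map on the finite set of tops, hence onto, so
    every chain also has a successor. The ends of the light edges then form a zigzag cycle. *)
Lemma exists_start (x0 : T) : exists2 u0, top u0 = u0 & forall u, ~~ link u u0.
Proof.
have top_top x : top (top x) = top x by apply/esym/top_eq; case: (topP x).
have [/existsP[u0 /andP[/eqP ? /forallP ?]]|] :=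
  boolP [exists u0, (top u0 == u0) && [forall u, ~~ link u u0]]; first by exists u0.
rewrite negb_exists => /forallP nostart; exfalso.
have pred_ex u : top u = u -> exists2 p, top p = p & link p u.
  move=> tu; have := nostart u; rewrite tu eqxx /= negb_forall => /existsP[p].
  rewrite negbK => l; exists (top p) => //; apply: link_same l.
  by case: (topP p).
pose tops := [set u | top u == u].
pose pr u := odflt u [pick p | (top p == p) && link p u].
have prP u : u \in tops -> (pr u \in tops) && link (pr u) u.
  rewrite inE => /eqP /pred_ex[p tp pu]; rewrite /pr.
  case: pickP => [q /andP[tq qu]|/(_ p)]; first by rewrite inE tq.
  by rewrite tp eqxx pu.
have pr_onto : pr @: tops = tops.
  apply/eqP; rewrite eqEcard card_in_imset ?leqnn ?andbT; last first.
    move=> u v /prP/andP[_ lu] /prP/andP[_ lv] uv; rewrite uv in lu.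
    exact: link_fun lu lv.
  by apply/subsetP => _ /imsetP[u /prP/andP[? _] ->].
have next_ex u : top u = u -> exists v, link u v.
  move=> tu; have : u \in pr @: tops by rewrite pr_onto inE tu.
  by case/imsetP=> v /prP/andP[_ l] uE; exists v; rewrite uE.
pose C := [set x | [exists y, light x y]].
have inC x y : light x y -> x \in C by move=> l; rewrite inE; apply/existsP; exists y.
have [v0 /linkP[z0 [_ l0 _]]] := next_ex _ (top_top x0).
apply: (no_zigzag_cycle (inC _ _ l0)) => x; rewrite inE => /existsP[y l].
have not_both p q z : light z p -> lt p z -> light z q -> lt z q -> False.
  move=> l1 h1 l2 h2; have [w hw] : exists w, heavy z w.
    by apply: heavy_nbr; case/andP: l1 => + _; apply.
  exact: lt_asym (light_low l2 h2 hw) (light_high l1 h1 hw).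
have e_split w : e x w -> w != y -> heavy x w.
  move=> xw wy; apply: contraNT wy; rewrite -heavy_light // => l'.
  by rewrite (light_unique l l').
have xy : e x y by case/andP: l.
have yC : y \in C by apply: (inC _ x); rewrite lightC.
(* The two neighbours of [x] in [C] are its light partner [y] and the opposite end of its own chain:
   the bottom if [y] is below [x], the top otherwise. *)
move: (xy); rewrite eE => /orP[] side; last first.
  have tx : top x = x by apply: top_id => z; apply: light_high l side.
  have [v /linkP[x' [xx' l' x'v]]] := next_ex _ tx.
  have nx : x != x'.
    by apply/eqP => xx; rewrite -xx in l' x'v; exact: (not_both _ _ _ l side l' x'v).
  have hx : heavy x x' by move: xx'; rewrite /same (negbTE nx).
  exists y, x'; split => //.
  - exact: inC l'.
  - by apply: contraTneq l => ->; rewrite heavy_light ?hx //; case/andP: hx.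
  - move=> w wC; apply/idP/orP => [xw|[]/eqP->//]; last by case/andP: hx.
    have [->|wy] := eqVneq w y; [by left|right].
    have hw := e_split _ xw wy; move: wC; rewrite inE => /existsP[q lq].
    have wx := light_high l side hw.
    have wq : lt w q.
      have := lq; rewrite /light eE => /andP[/orP[]// qw _].
      case: (lt_asym wx); apply: (light_high lq qw); by rewrite heavyC.
    apply/eqP/pos_inj; last by rewrite (light_pos0 lq wq) (light_pos0 l' x'v).
    by apply: same_trans xx'; rewrite /same heavyC hw orbT.
  by rewrite side (light_high l side hx).
have ttx : top (top x) = top x := top_top x.
have [p _ /linkP[x' [_ l' x'u]]] := pred_ex _ ttx.
have lu : light (top x) x' by rewrite lightC.
have nx : x != top x.
  apply/eqP => xt; rewrite -xt in lu x'u; exact: (not_both _ _ _ lu x'u l side).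
have xu : same x (top x) by case: (topP x).
have hx : heavy x (top x) by move: xu; rewrite /same (negbTE nx).
exists y, (top x); split => //.
- exact: inC lu.
- by apply: contraTneq l => ->; rewrite heavy_light ?hx //; case/andP: hx.
- move=> w wC; apply/idP/orP => [xw|[]/eqP->//]; last by case/andP: hx.
  have [->|wy] := eqVneq w y; [by left|right].
  have hw := e_split _ xw wy; move: wC; rewrite inE => /existsP[q lq].
  have xw' := light_low l side hw.
  have qw : lt q w.
    have := lq; rewrite /light eE => /andP[/orP[]// wq _].
    case: (lt_asym xw'); apply: (light_low lq wq); by rewrite heavyC.
  apply/eqP; rewrite -[LHS](@top_id w) => [|z]; last exact: light_high lq qw.
  by apply: top_eq; rewrite /same heavyC hw orbT.
by rewrite side (light_low l side hx) orbT.
Qed.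

Definition has_next u := [exists y, link u y].
Definition next_top u := odflt u [pick y | link u y].

Lemma next_topP u : has_next u -> link u (next_top u).
Proof. by case/existsP=> y l; rewrite /next_top; case: pickP => // /(_ y); rewrite l. Qed.

Section Walk.
Variable u0 : T.
Hypotheses (top_u0 : top u0 = u0) (start_u0 : forall u, ~~ link u u0).
Let u_ i := iter i next_top u0.

Lemma walk_link m i : (forall k, (k < m)%N -> has_next (u_ k)) -> (i < m)%N ->
  link (u_ i) (u_ i.+1).
Proof. by move=> h im; apply: next_topP; apply: h. Qed.

Lemma walk_top m i : (forall k, (k < m)%N -> has_next (u_ k)) -> (i <= m)%N ->
  top (u_ i) = u_ i.
Proof. by case: i => // i h im; apply: link_top (walk_link h im). Qed.

Lemma walk_inj m i j : (forall k, (k < m)%N -> has_next (u_ k)) ->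
  (i < j <= m)%N -> u_ i != u_ j.
Proof.
move=> h; elim: i j => [|i IH] [|j] // /andP[ij jm].
  by apply/eqP => E; have := walk_link h jm; rewrite -E (negbTE (start_u0 _)).
have im : (i < m)%N by apply: leq_trans jm; apply: ltnW.
have := IH j; rewrite -ltnS ij (ltnW jm) => /(_ isT); apply: contraNneq => E.
rewrite -(walk_top h (ltnW im)) -(walk_top h (ltnW jm)); apply/eqP/top_eq.
by apply: link_inj (walk_link h jm); rewrite -E; apply: walk_link h im.
Qed.

Lemma walk_uniq m : (forall k, (k < m)%N -> has_next (u_ k)) -> uniq (mkseq u_ m.+1).
Proof.
move=> h; apply/(uniqPn u0) => -[i [j [ij]]]; rewrite size_mkseq => jm.
rewrite !nth_mkseq //; last by apply: ltn_trans jm.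
by apply/eqP/(walk_inj h); rewrite ij -ltnS.
Qed.

Lemma walk_end : exists2 m, ~~ has_next (u_ m) & forall k, (k < m)%N -> has_next (u_ k).
Proof.
have ex : exists m, ~~ has_next (u_ m).
  have [/forallP h|] := boolP [forall k : 'I_#|T|, has_next (u_ k)]; last first.
    by rewrite negb_forall => /existsP[k ?]; exists k.
  have h' k : (k < #|T|)%N -> has_next (u_ k) by move=> kT; apply: (h (Ordinal kT)).
  have /card_uniqP := walk_uniq h'; rewrite size_mkseq => E.
  by have := max_card (mem (mkseq u_ #|T|.+1)); rewrite E ltnn.
case: (ex_minnP ex) => m nm mn; exists m => // k; rewrite ltnNge; apply: contraNT.
exact: mn.
Qed.

End Walk.

(** Chains are numbered along the walk from a chain without predecessor. A heavy edge stays in its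
    chain and a light one leads to the next or previous chain, so by connectedness the walk meets
    all of them. *)
Lemma wattle_structure (x0 : T) : exists ns, [/\ iso_to_wattle le ns,
  (0 < size ns)%N, all (fun n => 0 < n)%N ns & (1 < size ns)%N -> all (fun n => 1 < n)%N ns].
Proof.
have [u0 tu0 su0] := exists_start x0.
have [m nm hm] := walk_end tu0 su0; pose u_ i := iter i next_top u0.
pose ts := mkseq u_ m.+1; have uts : uniq ts := walk_uniq tu0 su0 hm.
have tst : size ts = m.+1 by rewrite size_mkseq.
have tsE i : (i <= m)%N -> nth u0 ts i = u_ i by move=> im; rewrite nth_mkseq.
have u_in i : (i <= m)%N -> u_ i \in ts by move=> im; rewrite -tsE // mem_nth ?tst.
have u_idx i : (i <= m)%N -> index (u_ i) ts = i.
  by move=> im; rewrite -tsE // index_uniq ?tst.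
have u_top i : (i <= m)%N -> top (u_ i) = u_ i by move=> im; apply: (walk_top tu0 hm im).
have u_link i : (i < m)%N -> link (u_ i) (u_ i.+1) by move=> im; apply: (walk_link hm im).
have tsP x : x \in ts -> exists2 i, (i <= m)%N & x = u_ i.
  by case/mapP=> i; rewrite mem_iota ltnS => im ->; exists i.
have link_next x y i : (i <= m)%N -> top x = u_ i -> link x y -> (i < m)%N /\ y = u_ i.+1.
  move=> im xi l; have l' : link (u_ i) y.
    by rewrite -xi; apply: link_same l; case: (topP x).
  have im' : (i < m)%N.
    rewrite ltn_neqAle im andbT; apply: contraTneq l' => ->.
    by move: nm; rewrite negb_exists => /forallP.
  by split=> //; apply: link_fun l' (u_link _ im').
have lt_link x y : light x y -> lt x y -> link x y.
  by move=> l xy; apply/linkP; exists x; rewrite same_refl.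
have cover : forall x, top x \in ts.
  apply: (connected_ind (x0 := u0)) => [|x y xts xy].
    by rewrite tu0; apply: (u_in 0%N).
  have [h|] := boolP (heavy x y).
    by rewrite -(top_eq (x := x)) // /same h orbT.
  rewrite -heavy_light // => l; have [i im xi] := tsP _ xts.
  move: (xy); rewrite eE => /orP[] side.
    have [im' ->] := link_next _ _ _ im xi (lt_link _ _ l side).
    by rewrite u_top // u_in.
  have tx : top x = x by apply: top_id => z; apply: light_high l side.
  have yx : link y x by apply: lt_link; rewrite // lightC.
  case: i im xi => [|i] im xi.
    by move: yx; rewrite -tx xi (negbTE (su0 _)).
  have -> : top y = u_ i; last exact/u_in/ltnW.
  rewrite -(u_top i (ltnW im)); apply: top_eq; apply: link_inj yx _.
  by rewrite -tx xi; apply: u_link.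
pose idx x := index (top x) ts.
have idx_lt x : (idx x <= m)%N by rewrite -ltnS -tst index_mem.
have idxE x : top x = u_ (idx x) by rewrite -tsE // nth_index.
have idx_same x y : (idx x == idx y) = same x y.
  apply/eqP/idP => [E|/top_eq E]; last by rewrite /idx E.
  by apply: top_same; rewrite !idxE E.
pose ns := [seq #|cls u| | u <- ts].
have nst : size ns = m.+1 by rewrite size_map.
have nsE x : nth 0%N ns (idx x) = #|cls x|.
  rewrite (nth_map u0) ?tst ?ltnS // nth_index //.
  by rewrite -(cls_eq (x := x)) //; case: (topP x).
have idx_link x y : light x y -> lt x y ->
    [/\ idx y = (idx x).+1, pos x = 0%N & pos y = #|cls y|.-1].
  move=> l xy; have [im yE] := link_next _ _ _ (idx_lt x) (idxE x) (lt_link _ _ l xy).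
  split; last by apply: pos_top => z; apply: (light_high _ xy); rewrite lightC.
    by rewrite /idx yE u_top // u_idx.
  exact: light_pos0 l xy.
exists ns; split.
- exists (fun x => (idx x, pos x)); split.
  + move=> x y [ixy pxy]; apply: pos_inj pxy; by rewrite -idx_same ixy.
  + by move=> x; rewrite /wattle_elem [_.1]/= [_.2]/= nst ltnS idx_lt nsE pos_cls.
  + case=> i k; rewrite /wattle_elem [_.1]/= [_.2]/= nst ltnS => /andP[im].
    rewrite (nth_map u0) ?tst // tsE // => /pos_onto[y uy <-]; exists y.
    by rewrite /idx -(top_eq uy) u_top // u_idx.
  move=> x y; rewrite /wattle_le [(idx x, _).1]/= [(idx y, _).1]/=.
  rewrite [(idx x, _).2]/= [(idx y, _).2]/= idx_same nsE.
  have [refl anti _] := le_po.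
  have [->|xy] := eqVneq x y; first by rewrite refl same_refl leqnn.
  have leE : le x y = lt x y by rewrite /lt /pstrict xy.
  rewrite leE; apply/idP/orP => [lxy|[/andP[]|/and3P[/eqP ixy /eqP px /eqP py]]].
  + have exy : e x y by rewrite eE lxy.
    have [h|] := boolP (heavy x y).
      by left; rewrite /same h orbT ltnW // pos_lt.
    rewrite -heavy_light // => l; have [-> -> ->] := idx_link _ _ l lxy.
    by right; rewrite !eqxx.
  + rewrite /same (negbTE xy) /= => h; have := h; rewrite /heavy eE => /andP[/orP[]// yx _].
    by rewrite leqNgt pos_lt // heavyC.
  have im : (idx x < m)%N by rewrite -ixy idx_lt.
  have /linkP[x' [ux' l x'y]] := u_link _ im.
  have yE : y = u_ (idx x).+1.
    rewrite -ixy -idxE; have [yt pt] := topP y.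
    by apply: pos_inj; rewrite // py pt.
  have xE : x = x'.
    apply: pos_inj; last by rewrite px (light_pos0 l x'y).
    by apply: same_trans ux'; rewrite -idxE; case: (topP x).
  by rewrite yE {1}xE.
- by rewrite nst.
- by apply/allP => _ /mapP[u _ ->]; rewrite (leq_ltn_trans _ (pos_cls u)).
rewrite nst ltnS => m0; apply/allP => _ /mapP[u _ ->].
have /linkP[x [_ l _]] := u_link _ m0.
have [y uy] : exists y, e u y by apply: connected_nbr; case/andP: l => + _; apply.
have [z hz] := heavy_nbr uy.
rewrite (cardD1 u) inE same_refl (cardD1 z) !inE /same hz orbT andbT.
by rewrite eq_sym; case/andP: hz => /neq ->.
Qed.

End Structure.

(** * The weight equation on a wattle *)

Definition excess (ns : seq nat) (i : nat) : nat := \sum_(j < i) (nth 0%N ns j).-1.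

(* [excess ns i] is the integer part of [r i] for [r = (excess ns t + 1) / t], where [t]
   is the number of chains, and [r i] is not an integer for [0 < i < t]. *)
Definition balanced (ns : seq nat) : Prop := forall i, (0 < i < size ns)%N ->
  (excess ns i * size ns < i * (excess ns (size ns)).+1 < (excess ns i).+1 * size ns)%N.

Definition wattle_sizes (ns : seq nat) : Prop :=
  [/\ (0 < size ns)%N, all (fun n => 0 < n)%N ns & (1 < size ns)%N -> all (fun n => 1 < n)%N ns].

Lemma excessS ns i : excess ns i.+1 = (excess ns i + (nth 0%N ns i).-1)%N.
Proof. by rewrite /excess big_ord_recr. Qed.

Section Coordinates.
Variables (R : realFieldType) (T : finType) (le : rel T) (ns : seq nat) (x0 : T).
Variable phi : T -> nat * nat.
Hypotheses (phi_inj : injective phi) (phi_in : forall x, wattle_elem ns (phi x))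
  (phi_onto : forall p, wattle_elem ns p -> exists x, phi x = p)
  (phi_le : forall x y, le x y = wattle_le ns (phi x) (phi y)).
Hypothesis ns_ok : wattle_sizes ns.
Let e := cmp le.
Let t := size ns.
Let nn i := nth 0%N ns i.
Let idx x := (phi x).1.
Let pos x := (phi x).2.

Definition elt i k : T := odflt x0 [pick x | phi x == (i, k)].
Definition bot i := elt i 0.
Definition topw i := elt i (nth 0%N ns i).-1.

Let t_gt0 : (0 < t)%N. Proof. by case: ns_ok. Qed.

Lemma nn_gt0 i : (i < t)%N -> (0 < nn i)%N.
Proof. by move=> it; case: ns_ok => _ /allP h _; apply/h/mem_nth. Qed.

Lemma nn_gt1 i : (1 < t)%N -> (i < t)%N -> (1 < nn i)%N.
Proof. by move=> t1 it; case: ns_ok => _ _ /(_ t1)/allP h; apply/h/mem_nth. Qed.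

Lemma eltP i k : (i < t)%N -> (k < nn i)%N -> phi (elt i k) = (i, k).
Proof.
move=> it kn; rewrite /elt; case: pickP => [x /eqP//|no].
have [|x xE] := phi_onto (p := (i, k)); first by rewrite /wattle_elem it kn.
by have := no x; rewrite xE eqxx.
Qed.

Lemma botP i : (i < t)%N -> phi (bot i) = (i, 0%N).
Proof. by move=> it; rewrite eltP // nn_gt0. Qed.

Lemma topwP i : (i < t)%N -> phi (topw i) = (i, (nn i).-1).
Proof. by move=> it; rewrite eltP // prednK ?nn_gt0. Qed.

Lemma idx_lt x : (idx x < t)%N. Proof. by case/andP: (phi_in x). Qed.
Lemma pos_lt_nn x : (pos x < nn (idx x))%N. Proof. by case/andP: (phi_in x). Qed.

Lemma phiE x : phi x = (idx x, pos x).
Proof. by rewrite /idx /pos; case: (phi x). Qed.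

Lemma cmp_wattle x y : e x y = (y != x) &&
  [|| idx y == idx x,
      [&& idx y == (idx x).+1, pos x == 0%N & pos y == (nn (idx y)).-1]
    | [&& idx x == (idx y).+1, pos y == 0%N & pos x == (nn (idx x)).-1]].
Proof.
rewrite /e /cmp !phi_le /wattle_le -/(idx x) -/(idx y) -/(pos x) -/(pos y) -/(nn _) -/(nn _).
case: (y != x) => //=; rewrite [idx x == idx y]eq_sym.
have [_|_] := eqVneq (idx y) (idx x); last by rewrite orbC.
by case: (leqP (pos y) (pos x)) => //= /ltnW ->; rewrite orbT.
Qed.

Definition chain_sum (h : T -> R) i := \sum_(y | idx y == i) h y.

Lemma lap_wattle (h : T -> R) x : lap e h x = h x + chain_sum h (idx x)
  + (if (pos x == 0%N) && ((idx x).+1 < t)%N then h (topw (idx x).+1) else 0)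
  + (if (pos x == (nn (idx x)).-1) && (0 < idx x)%N then h (bot (idx x).-1) else 0).
Proof.
rewrite /lap (bigID (fun y => idx y == idx x)) /=.
rewrite [X in _ + (_ + X)](bigID (fun y => idx y == (idx x).+1)) /=.
have -> : \sum_(y | e x y && (idx y == idx x)) h y = chain_sum h (idx x) - h x.
  rewrite /chain_sum [X in _ = X - _](bigD1 x) //= addrAC subrr add0r.
  apply: eq_bigl => y; rewrite cmp_wattle.
  by case: (y == x); case: (idx y == idx x); rewrite ?andbF.
set A := \sum_(_ | _) _; set B := \sum_(_ | _) _.
set C := if _ then _ else _; set D := if _ then _ else _.
suff [-> ->] : A = C /\ B = D by ring.
split.
  rewrite /A /C; case: ifP => [/andP[px ix]|no].
    rewrite (eq_bigl (pred1 (topw (idx x).+1))) ?big_pred1_eq // => y /=.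
    apply/idP/eqP => [|->].
      case/andP=> /andP[+ n1] /eqP ixy; rewrite cmp_wattle (negbTE n1) => /andP[_] /=.
      rewrite -ixy eqxx => /orP[/and3P[_ _ /eqP py]|/andP[/eqP]]; last by lia.
      by apply: phi_inj; rewrite topwP ?idx_lt // phiE py.
    rewrite cmp_wattle /idx /pos topwP //= -/(idx x) -/(pos x) px !eqxx.
    have -> : (idx x).+1 == idx x = false by lia.
    rewrite /= ?andbT; apply/eqP => E; have := congr1 idx E; rewrite /idx topwP //= -/(idx x); lia.
  rewrite big_pred0 // => y; apply/negP => /andP[/andP[+ n1] /eqP ixy].
  rewrite cmp_wattle (negbTE n1) => /andP[_] /=; rewrite ixy eqxx.
  case/orP=> [/and3P[_ px _]|/andP[/eqP]]; last by lia.
  by move: no; rewrite px -ixy idx_lt.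
rewrite /B /D; case: ifP => [/andP[px ix]|no].
  rewrite (eq_bigl (pred1 (bot (idx x).-1))) ?big_pred1_eq // => y /=.
  have it : ((idx x).-1 < t)%N by apply: leq_ltn_trans (idx_lt x); apply: leq_pred.
  apply/idP/eqP => [|->].
    case/andP=> /andP[+ n1] n2; rewrite cmp_wattle (negbTE n1) (negbTE n2) => /andP[_] /=.
    by case/and3P=> /eqP ixy /eqP py _; apply: phi_inj; rewrite botP // phiE py ixy.
  rewrite cmp_wattle /idx /pos botP //= -/(idx x) -/(pos x) px prednK // !eqxx.
  have -> : (idx x).-1 == idx x = false by lia.
  have -> : (idx x).-1 == (idx x).+1 = false by lia.
  rewrite /= ?andbT; apply/eqP => E; have := congr1 idx E; rewrite /idx botP //= -/(idx x); lia.
rewrite big_pred0 // => y; apply/negP => /andP[/andP[+ n1] n2].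
rewrite cmp_wattle (negbTE n1) (negbTE n2) => /andP[_] /= /and3P[/eqP ixy _ px].
by move: no; rewrite px ixy.
Qed.

Lemma card_chain i : (i < t)%N -> #|[pred y | idx y == i]| = nn i.
Proof.
move=> it; have inj : injective (fun k : 'I_(nn i) => elt i k).
  move=> k l /(congr1 phi); rewrite !eltP // => -[kl]; exact: val_inj.
rewrite -[RHS]card_ord -(card_codom inj); apply: eq_card => y; rewrite !inE.
apply/eqP/codomP => [iy|[k ->]]; last by rewrite /idx eltP.
have ky : (pos y < nn i)%N by rewrite -iy pos_lt_nn.
by exists (Ordinal ky); apply: phi_inj; rewrite eltP //= phiE iy.
Qed.

Section Constant.
Variables (h : T -> R) (c : R).
Hypothesis hc : forall x, lap e h x = c.
Let s := chain_sum h 0.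
Let b := c - s.

(** The gradient equations at the two ends of a link share the sum of the two end values and differ
    only in the chain sum. As the chains have at least two elements, neither end lies on a second
    link. *)
Lemma chain_link i : (i.+1 < t)%N ->
  h (bot i) + h (topw i.+1) + chain_sum h i = c /\
  chain_sum h i.+1 = chain_sum h i.
Proof.
move=> it; have it' := ltnW it; have t1 : (1 < t)%N by apply: leq_ltn_trans it.
have n1 := nn_gt1 t1 it'; have n2 := nn_gt1 t1 it.
have := hc (bot i); rewrite lap_wattle /idx /pos botP //= it.
have -> : (0%N == (nn i).-1) = false by lia.
rewrite addr0 => E1.
have := hc (topw i.+1); rewrite lap_wattle /idx /pos topwP //= eqxx /=.
have -> : ((nn i.+1).-1 == 0%N) = false by lia.
by rewrite /= addr0 => E2; split; lra.
Qed.

Lemma chain_sumE i : (i < t)%N -> chain_sum h i = s.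
Proof. by elim: i => // i IH it; rewrite (chain_link it).2 IH // ltnW. Qed.

Lemma bot_top i : (i.+1 < t)%N -> h (bot i) + h (topw i.+1) = b.
Proof. move=> it; have [E _] := chain_link it.
by rewrite (chain_sumE (ltnW it)) in E; rewrite /b -E addrK.
Qed.

Lemma other_value x : ~~ ((pos x == 0%N) && ((idx x).+1 < t)%N) ->
  ~~ ((pos x == (nn (idx x)).-1) && (0 < idx x)%N) -> h x = b.
Proof.
move=> n1 n2; have := hc x; rewrite lap_wattle (negbTE n1) (negbTE n2).
by rewrite chain_sumE ?idx_lt // /b; lra.
Qed.

Lemma chain_balance i : (i < t)%N -> s - (nn i)%:R * b =
  (if (i.+1 < t)%N then h (bot i) - b else 0) + (if (0 < i)%N then h (topw i) - b else 0).
Proof.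
move=> it; rewrite -(chain_sumE it) -(card_chain it) -sum1_card natr_sum mulr_suml.
rewrite /chain_sum -sumrB /=.
have -> : \sum_(y | idx y == i) (h y - 1 * b) =
  \sum_(y | idx y == i) (if (y == bot i) && (i.+1 < t)%N then h (bot i) - b else 0) +
  \sum_(y | idx y == i) (if (y == topw i) && (0 < i)%N then h (topw i) - b else 0).
  rewrite -big_split; apply: eq_bigr => y /eqP iy /=; rewrite mul1r.
  have yb : (y == bot i) = (pos y == 0%N).
    apply/eqP/eqP => [->|py]; first by rewrite /pos botP.
    by apply: phi_inj; rewrite botP // phiE iy py.
  have yt : (y == topw i) = (pos y == (nn i).-1).
    apply/eqP/eqP => [->|py]; first by rewrite /pos topwP.
    by apply: phi_inj; rewrite topwP // phiE iy py.
  have other := @other_value y; rewrite iy -yb -yt in other.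
  case: ifP => [/andP[/eqP yE i1]|/negbT n1]; last first.
    case: ifP => [/andP[/eqP-> _]|/negbT n2]; first by rewrite add0r.
    by rewrite (other n1 n2) subrr addr0.
  have -> : (y == topw i) = false.
    have n1 := nn_gt1 (leq_ltn_trans (isT : (0 < i.+1)%N) i1) it.
    by rewrite yt; move: yb; rewrite yE eqxx => /esym/eqP->; lia.
  by rewrite addr0 yE.
have one v (P : bool) F : idx v = i ->
    \sum_(y | idx y == i) (if (y == v) && P then F else 0) = if P then F else 0 :> R.
  move=> iv; rewrite (bigD1 v) /= ?iv //= eqxx /= big1 ?addr0 // => y /andP[_ /negbTE ->].
  by [].
by rewrite !one // /idx ?botP ?topwP.
Qed.

(** Add up the first chains: an element off the links contributes [b], a whole link also contributes
    [b], and the last bottom is left over because its partner lies in the next chain. *)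
Lemma partial_balance i : (i.+1 < t)%N ->
  i.+1%:R * s = (excess ns i.+1)%:R * b + h (bot i).
Proof.
have pred_nn j : (j < t)%N -> (nn j).-1%:R = (nn j)%:R - 1 :> R.
  by move=> jt; rewrite -subn1 natrB ?nn_gt0.
elim: i => [|i IH] it.
  have := chain_balance (ltnW it); rewrite it ltnn /= => E.
  by rewrite excessS /excess big_ord0 add0n pred_nn 1?ltnW //; lra.
have it' := ltnW it; have := chain_balance it'; rewrite it /= => E.
rewrite excessS natrD (pred_nn _ it') -natr1 !mulrDl IH //.
by have := bot_top it'; lra.
Qed.

Lemma total_balance : t%:R * s = (excess ns t).+1%:R * b.
Proof.
case E : t => [|[|k]]; first by have := t_gt0; rewrite E.
  have := chain_balance t_gt0; rewrite E /= addr0 => /eqP; rewrite subr_eq0 => /eqP sE.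
  by rewrite excessS /excess big_ord0 add0n prednK ?nn_gt0 // mul1r.
have k1 : (k.+1 < t)%N by rewrite E.
have := chain_balance k1; rewrite {1}E ltnn /= add0r => E0.
have -> : (excess ns k.+2).+1 = (excess ns k.+1 + nn k.+1)%N.
  by rewrite excessS -addnS prednK // nn_gt0.
rewrite -[k.+2]addn1 !natrD !mulrDl partial_balance //.
by have := bot_top k1; lra.
Qed.

Lemma value_cases x : h x = b \/ exists2 i, (i.+1 < t)%N & x = bot i \/ x = topw i.+1.
Proof.
have [/andP[/eqP px ix]|n1] := boolP ((pos x == 0%N) && ((idx x).+1 < t)%N).
  by right; exists (idx x) => //; left; apply: phi_inj; rewrite botP ?idx_lt // phiE px.
have [/andP[/eqP px ix]|n2] := boolP ((pos x == (nn (idx x)).-1) && (0 < idx x)%N).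
  right; exists (idx x).-1; rewrite prednK ?idx_lt //; right.
  by apply: phi_inj; rewrite topwP ?idx_lt // phiE px.
by left; apply: other_value.
Qed.

End Constant.

End Coordinates.

(** * The sizes of zeta(r) *)

Lemma denq_dvd (x : rat) (n : nat) (z : int) : x * n%:R = z%:~R -> (`|denq x| %| n)%N.
Proof.
move=> xn; have E : numq x * n%:Z = z * denq x.
  by apply: (@intr_inj rat); rewrite !intrM numqE -xn; ring.
have := congr1 absz E; rewrite !abszM absz_nat => E'.
have : (`|denq x| %| `|numq x| * n)%N by rewrite E' dvdn_mull.
by rewrite Gauss_dvdr // coprime_sym coprime_num_den.
Qed.

Lemma denq_subz (x : rat) (m : int) : `|denq (x - m%:~R)|%N = `|denq x|%N.
Proof.
have dE (y : rat) : y * `|denq y|%N%:R = (numq y)%:~R.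
  by rewrite numqE -[in RHS]absz_denq.
apply/eqP; rewrite eqn_dvd; apply/andP; split.
  apply: (@denq_dvd _ _ (numq x - m * `|denq x|%N%:Z)).
  by rewrite mulrBl dE intrB intrM.
apply: (@denq_dvd _ _ (numq (x - m%:~R) + m * `|denq (x - m%:~R)|%N%:Z)).
by rewrite intrD -dE intrM mulrBl subrK.
Qed.

Lemma floor_nonint (x : rat) (z : int) : z%:~R < x < (z + 1)%:~R -> Num.floor x = z.
Proof. by case/andP=> /ltW zx xz; apply: floor_def; rewrite zx. Qed.

(** With [r = M / t], balance puts [r * i] strictly between [excess ns i] and its successor for
    [0 < i < t]. This gives the integer parts and shows that no smaller multiplier makes [r]
    integral, so [t] is its denominator. *)
Lemma zeta_sizes_balanced ns : wattle_sizes ns -> balanced ns ->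
  exists r : rat, 1 <= r /\ zeta_sizes r = ns.
Proof.
move=> ok bal; case: (ok) => t0 pos pos1; set t := size ns.
pose M := (excess ns t).+1; pose r : rat := M%:R / t%:R.
have tR : (t%:R : rat) != 0 by rewrite pnatr_eq0 -lt0n.
have rt : r * t%:R = M%:R by rewrite /r divfK.
have tM : (t <= M)%N.
  case: (leqP t 1) => [t1|t1]; first by apply: leq_trans t1 _.
  suff h i : (i <= t)%N -> (i <= excess ns i)%N by apply: leqW; apply: h.
  elim: i => // i IH it; rewrite excessS.
  by have /= := allP (pos1 t1) _ (mem_nth 0%N it); have := IH (ltnW it); lia.
have r1 : 1 <= r by rewrite ler_pdivlMr ?mul1r ?ler_nat // ltr0n.
exists r; split=> //.
have bnd i : (0 < i < t)%N -> (excess ns i)%:R < r * i%:R < (excess ns i).+1%:R.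
  move=> it; have /andP[lo hi] := bal _ it.
  have t0R : 0 < (t%:R : rat) by rewrite ltr0n.
  rewrite -[X in X < _ < _](mulfK tR) -[X in _ < _ < X](mulfK tR) -!natrM.
  rewrite ltr_pdivrMr // ltr_pdivlMr //.
  by rewrite mulrAC rt mulrC -natrM !ltr_nat lo hi.
have fl i : (0 < i < t)%N -> Num.floor (r * i%:R) = excess ns i.
  move=> /bnd; rewrite -addn1 => h; apply: floor_nonint.
  by rewrite intrD -[1%:~R]/(1%:R : rat) -pmulrn -natrD.
rewrite /zeta_sizes; case: ifP => [/eqP d1|d1].
  have t1 : t = 1%N.
    apply/eqP; rewrite eqn_leq t0 andbT leqNgt; apply/negP => t1.
    have := bnd 1%N; rewrite t1 mulr1 => /(_ isT).
    have -> : r = (numq r)%:~R by rewrite numqE d1 mulr1.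
    by rewrite !pmulrn !ltr_int; lia.
  have rM : r = (M%:Z)%:~R by rewrite -pmulrn -rt t1 mulr1.
  rewrite rM intrKfloor absz_nat /M t1 excessS /excess big_ord0 add0n.
  have n0 : (0 < nth 0%N ns 0)%N by apply: (allP pos); rewrite mem_nth.
  rewrite prednK //; move: t1; rewrite /t.
  by case: (ns) => [|n []].
have t1 : (1 < t)%N.
  rewrite ltnNge; apply: contraFN d1 => t1.
  have tE : t = 1%N by apply/eqP; rewrite eqn_leq t1.
  have -> : r = (M%:Z)%:~R by rewrite -pmulrn -rt tE mulr1.
  by rewrite denq_int.
have dt : `|denq r|%N = t.
  have d0 : (0 < `|denq r|)%N by rewrite absz_gt0 denq_neq0.
  have dvd : (`|denq r| %| t)%N by apply: (@denq_dvd _ _ M); rewrite rt pmulrn.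
  apply/eqP; rewrite eqn_leq dvdn_leq //= leqNgt; apply/negP => dlt.
  have := bnd `|denq r|%N; rewrite d0 dlt => /(_ isT).
  have -> : r * `|denq r|%N%:R = (numq r)%:~R by rewrite numqE -[in RHS]absz_denq.
  by rewrite !pmulrn !ltr_int; lia.
rewrite denq_subz dt.
have f1 : Num.floor r = excess ns 1 by have := fl 1%N; rewrite t1 mulr1 => ->.
have ex1 : (excess ns 1).+1 = nth 0%N ns 0.
  rewrite excessS /excess big_ord0 add0n prednK //.
  by apply: (allP pos); rewrite mem_nth.
have nn1 j : (j < t)%N -> (0 < nth 0%N ns j)%N.
  by move=> jt; apply: (allP pos); rewrite mem_nth.
apply: (@eq_from_nth _ 0%N); first by rewrite size_map size_iota.
rewrite size_map size_iota => i it; rewrite (nth_map 0%N) ?size_iota // nth_iota // add1n.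
rewrite f1 absz_nat ex1 eqSS; case: eqP => [->//|i0] /=.
case: eqP => [itE|itn].
  (* The last chain is as long as the first one, by the symmetry i -> t - i. *)
  have tE : t = i.+1 by [].
  have b1 := bal 1%N; have bi := bal i.
  have h1 : (0 < 1 < size ns)%N by rewrite -/t t1.
  have hi : (0 < i < size ns)%N by rewrite -/t it; lia.
  move: (b1 h1) (bi hi); rewrite -/t tE !(excessS ns i).
  have := nn1 i it; move: ex1.
  move: (nth 0%N ns 0) (nth 0%N ns i) (excess ns i) (excess ns 1) => a c p q.
  move=> <- c0 /andP[lo1 up1] /andP[lo up].
  case: c c0 lo1 up1 lo up => // k _ /= lo1 up1 lo up; congr _.+1.
  case: (ltngtP q k) => // qk; have := leq_mul qk (leqnn i.+1); lia.
have iS : (i.+1 < t)%N by lia.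
rewrite !fl //; try lia.
by rewrite excessS; have := nn1 i it; lia.
Qed.

Lemma balanced_zeta_sizes (r : rat) : 1 <= r ->
  wattle_sizes (zeta_sizes r) /\ balanced (zeta_sizes r).
Proof.
move=> r1; rewrite /zeta_sizes; set m := Num.floor r.
have m1 : 0 < m by rewrite floor_gt0.
case: ifP => [_|/negbT d1].
  split; first by split=> //=; rewrite andbT; lia.
  by move=> i /=; case: i => [|[]].
rewrite denq_subz; set t := `|denq r|%N.
have t1 : (1 < t)%N.
  by have := denq_gt0 r; rewrite /t; lia.
pose F (i : nat) := Num.floor (r * i%:R).
have F1 : F 1%N = m by rewrite /F mulr1.
have rt : r * t%:R = (numq r)%:~R by rewrite numqE -[in RHS]absz_denq.
have Fitv i : (F i)%:~R <= r * i%:R < (F i + 1)%:~R := floor_itv _.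
have Fstrict i : (0 < i < t)%N -> (F i)%:~R < r * i%:R.
  move=> /andP[i0 it]; have /andP[lo _] := Fitv i.
  rewrite lt_neqAle lo andbT; apply/eqP => E.
  by have := dvdn_leq i0 (denq_dvd (esym E)); rewrite -/t leqNgt it.
have Fstep i : F i + 1 <= F i.+1.
  have /andP[lo _] := Fitv i.
  rewrite floor_ge_int intrD -natr1 mulrDr mulr1 lerD //.
pose nu i := if (i == 1%N) || (i == t) then (`|m|.+1)%N else (`|F i - F i.-1|.+1)%N.
rewrite -[X in wattle_sizes X]/(map nu (iota 1 t)) -[X in balanced X]/(map nu (iota 1 t)).
set ns := map nu _.
have nst : size ns = t by rewrite size_map size_iota.
have nsE j : (j < t)%N -> nth 0%N ns j = nu j.+1.
  by move=> jt; rewrite (nth_map 0%N) ?size_iota // nth_iota.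
have nu1 i : (1 < nu i.+1)%N.
  rewrite /nu; case: ifP => _; first by lia.
  by have := Fstep i; rewrite /=; lia.
have ok : all (fun n => 1 < n)%N ns.
  apply/(all_nthP 0%N) => i; rewrite nst => it; by rewrite nsE.
split.
  split; [by rewrite nst; lia | | by []].
  by apply: sub_all ok => n /=; lia.
have exE i : (0 < i < t)%N -> (excess ns i)%:Z = F i.
  elim: i => // i IH it; rewrite excessS; case: i IH it => [|i] IH it.
    by rewrite /excess big_ord0 nsE ?(ltnW t1) // /nu /= F1; lia.
  rewrite nsE; last by lia.
  rewrite PoszD IH; last by lia.
  rewrite /nu; have -> : (i.+2 == t) = false by lia.
  by have := Fstep i.+1; rewrite /=; lia.
have exT : (excess ns t).+1%:R = r * t%:R.
  have tp : t = t.-1.+1 by rewrite prednK // ltnW.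
  have e1 := exE t.-1; rewrite tp excessS nsE; last by rewrite -tp.
  have -> : nu t.-1.+1 = (`|m|.+1)%N by rewrite -tp /nu eqxx orbT.
  rewrite -tp rt /= -addnS natrD.
  have -> : (excess ns t.-1)%:R = (F t.-1)%:~R :> rat.
    by rewrite -e1 ?pmulrn //; lia.
  (* As [r] is not an integer, [r (t - 1) = numq r - r] has this integer part. The last size being
     [m + 1], the total excess is [numq r - 1]. *)
  have -> : F t.-1 = numq r - m - 1.
    rewrite /F; apply: floor_def; rewrite subrK intrB intrB.
    have -> : r * t.-1%:R = (numq r)%:~R - r.
      by rewrite -rt [in RHS]tp -natr1 mulrDr mulr1 addrK.
    have /andP[lo hi] := floor_itv r; rewrite -/m intrD in lo hi.
    have := Fstrict 1%N; rewrite t1 F1 mulr1 => /(_ isT) lo'.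
    apply/andP; split; lra.
  have -> : (`|m|.+1)%:R = (m + 1)%:~R :> rat.
    by rewrite pmulrn; congr _%:~R; lia.
  by rewrite -intrD; congr _%:~R; ring.
move=> i; rewrite nst => it.
have t0 : 0 < (t%:R : rat) by rewrite ltr0n ltnW.
have lo := Fstrict i it; have /andP[_ up] := Fitv i.
rewrite -!(ltr_nat rat) !natrM exT.
have -> : (excess ns i)%:R = (F i)%:~R :> rat by rewrite -exE // pmulrn.
have -> : (excess ns i).+1%:R = (F i + 1)%:~R :> rat.
  by rewrite pmulrn -exE //; congr _%:~R; lia.
have -> : i%:R * (r * t%:R) = r * i%:R * t%:R by ring.
by rewrite !ltr_pM2r // lo.
Qed.

(** * The two implications *)

Section Main.
Variables (R : realType) (T : finType) (le : rel T).
Hypothesis le_po : is_partial_order le.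
Let e := cmp le.

Lemma r_set_of_C_empty : hasse_connected le -> psd R le -> C_empty R le -> is_r_set le.
Proof.
move=> [T0 hconn] ps ce.
have pd : positive_definite R e := C_empty_positive_definite le_po ps ce.
have nd : no_dominated R e := C_empty_no_dominated ce.
have [lam [lam0 lam1]] := positive_weight (@cmp_sym T le) pd nd.
have conn x y : connect e x y.
  apply: connect_sub (hconn x y) => {x y} x y h; apply: connect1.
  rewrite /e cmpE; case/orP: h => /andP[+ _]; rewrite /pstrict => /andP[-> ->] //.
  by rewrite orbT.
case/card_gt0P: T0 => x0 _.
have [ns [iso ns0 ns1 ns2]] := wattle_structure le_po pd nd lam0 lam1 conn x0.
have ok : wattle_sizes ns by [].
case: iso => phi [inj pin onto ple].
suff bal : balanced ns.
  have [r [r1 rE]] := zeta_sizes_balanced ok bal.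
  by exists r; split=> //; rewrite rE; exists phi.
have tot := total_balance x0 inj pin onto ple ok lam1.
have part := partial_balance x0 inj pin onto ple ok lam1.
have bt := bot_top x0 inj pin onto ple ok lam1.
set s := chain_sum phi lam 0 in tot part bt; set b := 1 - s in tot part bt.
have t0 : 0 < ((size ns)%:R : R) by rewrite ltr0n.
have M0 : 0 < ((excess ns (size ns)).+1%:R : R) by rewrite ltr0n.
(* By the total balance [s] and [b] are proportional with a positive factor, and they add up to
   1. *)
have b0 : 0 < b.
  rewrite ltNge; apply/negP => b0.
  have : (size ns)%:R * s <= 0 by rewrite tot mulr_ge0_le0 // ltW.
  by rewrite pmulr_rle0 // => s0; have : b = 1 - s by []; lra.
case=> // i it; have it' : (i.+1 < size ns)%N by case/andP: it.
have E1 := part _ it'; have E2 := bt _ it'.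
have lb := lam0 (bot x0 phi i); have lt' := lam0 (topw ns x0 phi i.+1).
set y := lam (bot _ _ _) in E1 E2 lb.
(* Eliminating [s] between the partial and the total balance turns the inequalities of [balanced]
   into [0 < y < b], that is, positivity at both ends of the link. *)
have key : i.+1%:R * (excess ns (size ns)).+1%:R * b =
    (size ns)%:R * ((excess ns i.+1)%:R * b + y).
  by rewrite -E1 -mulrA -tot; ring.
apply/andP; split; rewrite -(ltr_nat R) !natrM -(ltr_pM2r b0) key -?natr1.
  have -> : (excess ns i.+1)%:R * (size ns)%:R * b =
    (size ns)%:R * ((excess ns i.+1)%:R * b) by ring.
  by rewrite ltr_pM2l //; lra.
have -> : ((excess ns i.+1)%:R + 1) * (size ns)%:R * b =
    (size ns)%:R * ((excess ns i.+1)%:R * b + b) by ring.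
by rewrite ltr_pM2l //; lra.
Qed.

(** Balance makes the solution [lam] of [lap lam = 1] positive. Pairing it with a nonnegative
    gradient [lap h] gives the sum of [h], which is 0, so [lap h = 0] and then [h = 0]. *)
Lemma C_empty_of_r_set : (0 < #|T|)%N -> is_r_set le -> C_empty R le.
Proof.
move=> /card_gt0P[x0 _] [r [r1]]; have [ok bal] := balanced_zeta_sizes r1.
move: (zeta_sizes r) ok bal => ns ok bal [phi [inj pin onto ple]].
have t0 : 0 < ((size ns)%:R : R) by case: ok => t0 _ _; rewrite ltr0n.
have M0 : 0 < ((excess ns (size ns)).+1%:R : R) by rewrite ltr0n.
have ker (h : T -> R) : (forall x, lap e h x = 0) -> forall x, h x = 0.
  move=> h0; have tot := total_balance x0 inj pin onto ple ok h0.
  have part := partial_balance x0 inj pin onto ple ok h0.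
  have bt := bot_top x0 inj pin onto ple ok h0.
  have vc := value_cases x0 inj pin onto ple ok h0.
  set s := chain_sum phi h 0 in tot part bt vc.
  (* For zero gradient [b] is [- s], so the total balance is a positive multiple of [s] set equal to
     0. *)
  have s0 : s = 0.
    apply/eqP; have : ((size ns)%:R + (excess ns (size ns)).+1%:R) * s = 0.
      by rewrite mulrDl tot; ring.
    by move/eqP; rewrite mulf_eq0 gt_eqF //= addr_gt0.
  rewrite s0 subrr in bt part vc tot.
  have hb i : (i.+1 < size ns)%N -> h (bot x0 phi i) = 0.
    by move=> it; have := part _ it; rewrite !mulr0 add0r.
  move=> x; case: (vc x) => [//|[i it [->|->]]]; first exact: hb.
  by have := bt _ it; rewrite hb // add0r.
have [lam lam1] := lap_onto ker (fun=> 1).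
have lam0 x : 0 < lam x.
  have tot := total_balance x0 inj pin onto ple ok lam1.
  have part := partial_balance x0 inj pin onto ple ok lam1.
  have bt := bot_top x0 inj pin onto ple ok lam1.
  have vc := value_cases x0 inj pin onto ple ok lam1.
  set s := chain_sum phi lam 0 in tot part bt vc; set b := 1 - s in tot part bt vc.
  have b0 : 0 < b.
    rewrite ltNge; apply/negP => b0.
    have : (size ns)%:R * s <= 0 by rewrite tot mulr_ge0_le0 // ltW.
    by rewrite pmulr_rle0 // => s0; have : b = 1 - s by []; lra.
  have bnd i : (i.+1 < size ns)%N -> 0 < lam (bot x0 phi i) < b.
    move=> it; have /andP[lo up] := bal i.+1 it.
    have E1 := part _ it; set y := lam _ in E1 *.
    have key : i.+1%:R * (excess ns (size ns)).+1%:R * b =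
    (size ns)%:R * ((excess ns i.+1)%:R * b + y).
      by rewrite -E1 -mulrA -tot; ring.
    rewrite -(ltr_nat R) !natrM -(ltr_pM2r b0) key in lo.
    rewrite -(ltr_nat R) !natrM -(ltr_pM2r b0) key -(natr1 (excess _ i.+1)) in up; move: lo up.
    have -> : (excess ns i.+1)%:R * (size ns)%:R * b =
    (size ns)%:R * ((excess ns i.+1)%:R * b) by ring.
    have -> : ((excess ns i.+1)%:R + 1) * (size ns)%:R * b =
    (size ns)%:R * ((excess ns i.+1)%:R * b + b) by ring.
    by rewrite !ltr_pM2l // => lo up; apply/andP; split; lra.
  case: (vc x) => [-> //|[i it [->|->]]]; first by case/andP: (bnd _ it).
  by have /andP[_ ub] := bnd _ it; have := bt _ it; lra.
have nonneg (h : T -> R) : inH0 h -> (forall i, 0 <= lap e h i) -> False.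
  move=> [s0 [i hi]] h0; move/negP: hi; apply; apply/eqP; apply: ker => j.
  have : \sum_i lam i * lap e h i = 0.
    rewrite lap_sym; last exact: cmp_sym.
    by rewrite -[RHS]s0; apply: eq_bigr => k _; rewrite lam1 mulr1.
  move/eqP; rewrite psumr_eq0 => [/allP/(_ j)|k _]; last by rewrite mulr_ge0 // ltW.
  by rewrite mem_index_enum mulf_eq0 gt_eqF //= => /(_ isT)/eqP.
move=> h [[H h0]|[H h0]]; first exact: nonneg H h0.
apply: (nonneg (fun i => -1 * h i)) => [|i].
  case: H => s0 [i hi]; split; first by rewrite -mulr_sumr s0 mulr0.
  by exists i; rewrite mulN1r oppr_eq0.
by rewrite lapZ mulN1r oppr_ge0; apply: h0.
Qed.

End Main.

Theorem mainTheorem1 (R : realType) (T : finType) (le : rel T) :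
  is_partial_order le ->
  hasse_connected le ->
  psd R le ->
  (C_empty R le <-> is_r_set le).
Proof.
move=> po hc ps; split; first exact: r_set_of_C_empty.
by apply: C_empty_of_r_set; case: hc.
Qed.
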